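(* Fix a prime power $q$. Let $\psi_1,\psi_2$ be arithmetic functions on $\mathbb{F}_q[t]$. If $\psi_1$ and $\psi_2$ both satisfy the growth condition, the Siegel-Walfisz bound and the Bombieri-Vinogradov type equidistribution property, then the Dirichlet convolution $\psi_1\ast\psi_2$ also satisfies the growth condition, the Siegel-Walfisz bound and the Bombieri-Vinogradov type equidistribution property.
   Context: $\mathbb{F}_q$ is the finite field with $q$ elements, and $q$ is fixed. In all sums below $f,g,h$ run over monic polynomials in $\mathbb{F}_q[t]$. An arithmetic function is a map $\psi:\mathbb{F}_q[t]\to\mathbb{C}$ (only its values on monic polynomials matter). $\tau(f)$ is the number of monic divisors of $f$, and $\phi(m)=\#(\mathbb{F}_q[t]/(m))^{*}$. The Dirichlet convolution is $\psi_1\ast\psi_2(f)=\sum_{gh=f}\psi_1(g)\psi_2(h)$, over monic $g,h$ with $gh=f$. A (multiplicative) character $\chi$ modulo a non-constant polynomial $m$ is a character of $(\mathbb{F}_q[t]/(m))^{*}$, extended to $\mathbb{F}_q[t]$ by $\chi(f)=\chi(f \bmod m)$ if $(f,m)=1$ and $\chi(f)=0$ otherwise. It is principal if $\chi(f)=1$ for all $f$ with $(f,m)=1$. Its conductor is the monic $d\mid m$ of least degree such that $\chi$ is induced by a (primitive) character modulo $d$. Here $\log$ is the logarithm to base $q$. For an arithmetic function $\psi$ define: Growth condition: $\psi(f)=O(\tau(f)^{C})$ for some $C>0$. Siegel-Walfisz bound: for all sufficiently large $D>0$, for a non-principal character $\chi$ with conductor of degree $\le D\log N$, $$\sum_{\deg(f)=N}\psi(f)\chi(f)=O\left(\frac{q^N}{N^{3D}}\right),$$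 with implied constant independent of $N$ and $\chi$. Bombieri-Vinogradov type equidistribution property: for $m,l\in\mathbb{F}_q[t]$ with $m$ monic and $(m,l)=1$, let $$E(M;m,l;\psi)=\sum_{\substack{f\equiv l\ (\mathrm{mod}\ m)\\ \deg(f)=M}}\psi(f)-\frac{1}{\phi(m)}\sum_{\substack{(f,m)=1\\ \deg(f)=M}}\psi(f).$$ Then for any $A>0$ there exists $B=B(A)>0$ such that $$\sum_{\deg(m)\le \frac N2-B\log N}\ \max_{M\le N}\ \max_{(m,l)=1}|E(M;m,l;\psi)|\ll_A\frac{q^N}{N^A},$$ the outer sum being over monic $m$. *)

(* Defs.v *)
From HB Require Import structures.
From mathcomp Require Import all_boot all_order all_algebra.
From mathcomp Require Import qpoly complex.
From mathcomp Require Import reals exp.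

Set Implicit Arguments.
Unset Strict Implicit.
Unset Printing Implicit Defensive.

Import Order.TTheory GRing.Theory Num.Theory.
Local Open Scope ring_scope.
Local Open Scope complex_scope.

(* The field F_q is an arbitrary [F : finFieldType], with q = #|F|, and the   *)
(* complex numbers are R[i] for R a realType. Polynomials of bounded degree   *)
(* are enumerated through the finite type {poly_n F} (size at most n).        *)

Definition pdeg (F : finFieldType) (f : {poly F}) : nat := (size f).-1.

Definition monic_deg (F : finFieldType) (n : nat) (f : {poly F}) : bool :=
  (f \is monic) && (pdeg f == n).

Definition logq (R : realType) (F : finFieldType) (x : R) : R :=
  ln x / ln #|F|%:R.

Definition tau (F : finFieldType) (f : {poly F}) : nat :=
  #|[set g : {poly_(size f) F} | ((g : {poly F}) \is monic)
                                 && ((g : {poly F}) %| f)]|.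

(* Residues mod m are represented by the polynomials of degree < deg m. The   *)
(* type {poly %/ m} is not suitable, as it is F[t]/(t) when m = 1.            *)
Definition phi (F : finFieldType) (m : {poly F}) : nat :=
  #|[set r : {poly_(pdeg m) F} |
      [exists s : {poly_(pdeg m) F},
         ((r : {poly F}) * (s : {poly F})) %% m == 1 %% m]]|.

Definition dirichlet_conv (R : realType) (F : finFieldType)
    (psi1 psi2 : {poly F} -> R[i]) (f : {poly F}) : R[i] :=
  \sum_(g : {poly_(size f) F} | (g : {poly F}) \is monic)
    \sum_(h : {poly_(size f) F} | ((h : {poly F}) \is monic)
                                  && ((g : {poly F}) * (h : {poly F}) == f))
      psi1 g * psi2 h.

(* A homomorphism from (F[t]/(m))^* to C^*, extended by 0; values on units    *)
(* are nonzero since the second and last two clauses make them invertible.    *)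
(* For m constant and nonzero the only such function is the constant 1.       *)
Definition character_mod (R : realType) (F : finFieldType) (m : {poly F})
    (chi : {poly F} -> R[i]) : Prop :=
  [/\ forall f, ~~ coprimep f m -> chi f = 0,
      forall f, chi f = chi (f %% m),
      chi 1 = 1 &
      forall f g, coprimep f m -> coprimep g m -> chi (f * g) = chi f * chi g].

Definition principal_mod (R : realType) (F : finFieldType) (m : {poly F})
    (chi : {poly F} -> R[i]) : Prop :=
  forall f, coprimep f m -> chi f = 1.

Definition induced_from (R : realType) (F : finFieldType) (m : {poly F})
    (chi : {poly F} -> R[i]) (d : {poly F}) : Prop :=
  exists chi' : {poly F} -> R[i],
    character_mod d chi' /\ (forall f, coprimep f m -> chi f = chi' f).

(* The inducing character is automatically primitive, by minimality of d.     *)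
Definition is_conductor (R : realType) (F : finFieldType) (m : {poly F})
    (chi : {poly F} -> R[i]) (d : {poly F}) : Prop :=
  [/\ d \is monic, d %| m, induced_from m chi d &
      forall e : {poly F}, e \is monic -> e %| m -> induced_from m chi e ->
        (pdeg d <= pdeg e)%N].

Definition growth_condition (R : realType) (F : finFieldType)
    (psi : {poly F} -> R[i]) : Prop :=
  exists2 C : R, 0 < C &
  exists K : R, forall f : {poly F}, f \is monic ->
    Normc.normc (psi f) <= K * (tau f)%:R `^ C.

Definition siegel_walfisz (R : realType) (F : finFieldType)
    (psi : {poly F} -> R[i]) : Prop :=
  exists2 D0 : R, 0 < D0 &
  forall D : R, D0 <= D ->
  exists K : R,
  forall (N : nat) (m d : {poly F}) (chi : {poly F} -> R[i]),
    (0 < N)%N -> (0 < pdeg m)%N ->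
    character_mod m chi -> ~ principal_mod m chi -> is_conductor m chi d ->
    (pdeg d)%:R <= D * logq F N%:R ->
    Normc.normc (\sum_(f : {poly_N.+1 F} | monic_deg N f) psi f * chi f)
      <= K * (#|F|%:R ^+ N / N%:R `^ (3 * D)).

Definition progression_error (R : realType) (F : finFieldType)
    (psi : {poly F} -> R[i]) (M : nat) (m l : {poly F}) : R[i] :=
  \sum_(f : {poly_M.+1 F} | monic_deg M f
                            && ((f : {poly F}) %% m == l %% m)) psi f
  - ((phi m)%:R)^-1 *
    \sum_(f : {poly_M.+1 F} | monic_deg M f && coprimep f m) psi f.

(* progression_error depends only on l mod m, so l runs over residues. For    *)
(* N > 0 and B > 0 the bound N/2 - B log N is at most N, hence the sum over   *)
(* {poly_N.+1 F} covers all the moduli.                                       *)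
Definition bombieri_vinogradov (R : realType) (F : finFieldType)
    (psi : {poly F} -> R[i]) : Prop :=
  forall A : R, 0 < A ->
  exists2 B : R, 0 < B &
  exists K : R, forall N : nat, (0 < N)%N ->
    \sum_(m : {poly_N.+1 F} | ((m : {poly F}) \is monic)
        && ((pdeg m)%:R <= N%:R / 2 - B * logq F N%:R))
      \big[Num.max/0]_(M < N.+1)
        \big[Num.max/0]_(l : {poly_(pdeg m) F} | coprimep m l)
          Normc.normc (progression_error psi M m l)
    <= K * (#|F|%:R ^+ N / N%:R `^ A).

(* Main.v *)
(* Induction principle of Motohashi. The Dirichlet convolution splits exactly  *)
(* by degrees: the error term of psi1 * psi2 is a sum over a + b = M of        *)
(* bilinear errors of the pieces deg g = a, deg h = b. If q^b (or q^a) is at    *)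
(* most a power of N, the bilinear error reduces to the equidistribution of    *)
(* psi1 (or psi2). Otherwise it is expanded in characters modulo m. Characters *)
(* of conductor bounded by a power of N are handled by the Siegel-Walfisz      *)
(* bound. For the others write m = d e with d the conductor, use               *)
(* 1 / phi(d e) <= tau(e) / (|e| phi(d)), and apply Cauchy-Schwarz and the     *)
(* large sieve, which over F_q[t] is just Bessel's inequality: a product of a  *)
(* primitive character and the conjugate of a different one is a nonprincipal  *)
(* character, and it sums to zero over all polynomials of degree < L once L is *)
(* at least the degree of the product of the two moduli.                       *)

Require Import Defs.
From mathcomp Require Import all_boot all_order all_fingroup all_algebra.
From mathcomp Require Import all_solvable all_field all_character.
From mathcomp Require Import qpoly complex.
From mathcomp Require Import boolp reals exp.
From mathcomp Require Import ring lra zify.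

Set Implicit Arguments.
Unset Strict Implicit.
Unset Printing Implicit Defensive.

Import Order.TTheory GRing.Theory Num.Theory.
Local Open Scope ring_scope.
Local Open Scope complex_scope.

(** * Enumerations of polynomials *)

(** Write |f| = q^(deg f). Over [F[t]] the degree is exact, so a sum of a convolution over monic f
    of degree n is the sum over a <= n of sums over pairs (g, h) of degrees a and n - a
    ([sum_mons_divs]). No dyadic cutting is needed, and the n + 1 pieces cost only one power of N.

    Growth holds because f has tau(f) factorisations into two monic factors. For Siegel-Walfisz, the
    character sum of the convolution is a sum of products of two character sums. The factor of
    degree at least N/2 gets the hypothesis at level 2D and saves N^(6D); the other gets a trivial
    bound with polynomial loss ([tau_moment], [growth_moments]), and N^(3D) is still saved.

    Equidistribution rests on [pair_bound], which treats a single pair of degrees (a, b). Outside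
    the easy ranges put X = N^E, with q^a and q^b above X^2. The principal character cancels the
    expected main term ([bilinear_error_dchar]), and the others are sorted by conductor d
    ([charbound_split]). At most q X^2 characters have |d| <= X, and Siegel-Walfisz saves a larger
    power of N on each. For deg d = s with q^s > X, [large_sieve] and Cauchy-Schwarz bound the
    weighted sum over primitive characters, up to constants and powers of N, by the square root of
    q^a (q^(a-s) + q^s) q^b (q^(b-s) + q^s). Each of the four terms of this product is at most (q^N
    / X)^2, because X < q^s, X^2 < q^a, X^2 < q^b and q^s X <= q^(N/2) ([block_numeric]). The last
    condition is where the level N/2 - B log N is used. Passing from d to its multiples m = d e
    costs only powers of N ([phi_mul_ge], [large_total]). *)

Lemma big_subset_le (R : numDomainType) (I : eqType) (s t : seq I) (G : I -> R) :
  uniq s -> uniq t -> {subset s <= t} -> (forall i, i \in t -> 0 <= G i) ->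
  \sum_(i <- s) G i <= \sum_(i <- t) G i.
Proof.
move=> us ut st G0.
have -> : \sum_(i <- s) G i = \sum_(i <- t | i \in s) G i.
  rewrite -[RHS]big_filter; apply: perm_big; apply: uniq_perm => //.
    exact: filter_uniq.
  by move=> i; rewrite mem_filter; case: (boolP (i \in s)) => // /st ->.
rewrite big_seq_cond [leRHS]big_seq (bigID (mem s) (fun i => i \in t)) /=.
by rewrite lerDl; apply: sumr_ge0 => i /andP[/G0].
Qed.

Section Enumeration.
Variable F : finFieldType.
Implicit Types f g h m r : {poly F}.

(** Duplicate-free lists of plain polynomials replace the types [{poly_n F}], so that reindexing
    between different degree bounds becomes a permutation of lists. *)
Definition polys n : seq {poly F} := [seq val p | p <- enum {: {poly_n F}}].

Definition mons n : seq {poly F} := [seq f <- polys n.+1 | monic_deg n f].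

Lemma mem_polys n f : (f \in polys n) = (size f <= n)%N.
Proof.
apply/mapP/idP => [[p _ ->]|fn]; first exact: size_npoly.
by exists (npolyp n f); rewrite ?mem_enum //= npolypK.
Qed.

Lemma polys_uniq n : uniq (polys n).
Proof. by rewrite map_inj_uniq ?enum_uniq //; exact: val_inj. Qed.

Lemma size_polys n : size (polys n) = (#|F| ^ n)%N.
Proof. by rewrite size_map -cardE card_npoly. Qed.

Lemma mons_uniq n : uniq (mons n).
Proof. by rewrite filter_uniq ?polys_uniq. Qed.

Lemma monic_deg_size n f : monic_deg n f -> size f = n.+1.
Proof.
case/andP=> fm /eqP; rewrite /pdeg => <-.
by rewrite prednK // size_poly_gt0 monic_neq0.
Qed.

Lemma mem_mons n f : (f \in mons n) = monic_deg n f.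
Proof.
rewrite mem_filter mem_polys; case: (boolP (monic_deg n f)) => // h.
by rewrite (monic_deg_size h) leqnn.
Qed.

Lemma mem_monsP n f : reflect (f \is monic /\ size f = n.+1) (f \in mons n).
Proof.
rewrite mem_mons; apply: (iffP idP) => [h|[h1 h2]].
  by split; [case/andP: h | exact: monic_deg_size].
by rewrite /monic_deg h1 /pdeg h2 eqxx.
Qed.

Lemma big_npoly (V : Type) (idx : V) (op : Monoid.com_law idx) n
    (P : pred {poly F}) (G : {poly F} -> V) :
  \big[op/idx]_(f : {poly_n F} | P f) G f = \big[op/idx]_(f <- polys n | P f) G f.
Proof. by rewrite /polys big_map big_enum_cond; apply: eq_bigl => i; rewrite inE. Qed.

Lemma sum_monic_deg (V : nmodType) n (P : pred {poly F}) (G : {poly F} -> V) :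
  \sum_(f : {poly_n.+1 F} | monic_deg n f && P f) G f
  = \sum_(f <- mons n | P f) G f.
Proof. by rewrite (big_npoly _ _ (fun f => monic_deg n f && P f)) big_filter_cond. Qed.

Lemma sum_monic_deg1 (V : nmodType) n (G : {poly F} -> V) :
  \sum_(f : {poly_n.+1 F} | monic_deg n f) G f = \sum_(f <- mons n) G f.
Proof. by rewrite -[RHS]sum_monic_deg; apply: eq_bigl => f; rewrite andbT. Qed.

Lemma perm_mons n : perm_eq (mons n) [seq 'X^n + r | r <- polys n].
Proof.
apply: uniq_perm; first exact: mons_uniq.
  by rewrite map_inj_uniq ?polys_uniq // => x y /addrI.
move=> f; apply/mem_monsP/mapP => [[fm sf]|[r]].
  exists (f - 'X^n); last by rewrite addrCA subrr addr0.
  rewrite mem_polys; apply/leq_sizeP => j; rewrite leq_eqVlt => /orP[/eqP <-|nj].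
    by rewrite coefB coefXn eqxx -[n in f`_n]/(n.+1.-1) -sf [f`_ _](monicP fm) subrr.
  by rewrite coefB coefXn gtn_eqF // subr0 nth_default // sf.
rewrite mem_polys => sr ->.
have sr' : (size r < size ('X^n : {poly F}))%N by rewrite size_polyXn ltnS.
split; last by rewrite size_polyDl // size_polyXn.
by apply/monicP; rewrite lead_coefDl // lead_coefXn.
Qed.

Lemma size_mons n : size (mons n) = (#|F| ^ n)%N.
Proof. by rewrite (perm_size (perm_mons n)) size_map size_polys. Qed.

Lemma modp_mul_add m (s r : {poly F}) : (size r < size m)%N -> (s * m + r) %% m = r.
Proof. by move=> rm; rewrite modpD modp_mull add0r modp_small. Qed.

Lemma perm_polys_divmod n m : m != 0 -> (pdeg m <= n)%N ->
  perm_eq (polys n) [seq s * m + r | s <- polys (n - pdeg m), r <- polys (pdeg m)].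
Proof.
move=> m0 mn; have sm : (pdeg m).+1 = size m by rewrite prednK // size_poly_gt0.
apply: uniq_perm; first exact: polys_uniq.
  apply: allpairs_uniq; rewrite ?polys_uniq //.
  move=> [s r] [s' r'] /allpairsP[[a b]] /= [_ hb [-> ->]].
  move=> /allpairsP[[c d]] /= [_ hd [-> ->]] /= e.
  rewrite mem_polys -ltnS sm in hb; rewrite mem_polys -ltnS sm in hd.
  have e2 : b = d by rewrite -(modp_mul_add a hb) e modp_mul_add.
  by move: e; rewrite /= e2 => /addIr /(mulIf m0) ->.
move=> f; rewrite mem_polys; apply/idP/allpairsP => [fn|[[s r] /= []]].
  exists (f %/ m, f %% m); rewrite !mem_polys /= size_divp //; split.
  - by rewrite leq_sub2r.
  - by rewrite -ltnS sm ltn_modp.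
  - exact: divp_eq.
rewrite !mem_polys => hs hr ->.
apply: leq_trans (size_polyD _ _) _; rewrite geq_max (leq_trans hr) // andbT.
have [->|s0] := eqVneq s 0; first by rewrite mul0r size_poly0.
by rewrite size_mul // -sm addnS /= (leq_trans (leq_add hs (leqnn _))) // subnK.
Qed.

(** By division with remainder each residue class occurs exactly q^(n - deg m) times. The absence of
    an error term is what later makes character orthogonality exact on long ranges. *)
Lemma sum_polys_mod (V : nmodType) n m (G : {poly F} -> V) :
  m != 0 -> (pdeg m <= n)%N ->
  \sum_(f <- polys n) G (f %% m)
  = (\sum_(r <- polys (pdeg m)) G r) *+ #|F| ^ (n - pdeg m).
Proof.
move=> m0 mn; rewrite (perm_big _ (perm_polys_divmod m0 mn)) /= big_allpairs_dep /=.
rewrite -size_polys -(count_predT (polys _)) -[RHS]addr0 -iter_addr -big_const_seq.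
apply: eq_big_seq => s _; apply: eq_big_seq => r; rewrite mem_polys => hr.
by rewrite modp_mul_add // (leq_ltn_trans hr) // ltn_predL size_poly_gt0.
Qed.
End Enumeration.

(** * Divisors *)

Lemma sum_const_seq (V : nmodType) (I : Type) (s : seq I) (c : V) :
  \sum_(i <- s) c = c *+ size s.
Proof. by rewrite big_const_seq count_predT iter_addr_0. Qed.

Section Divisors.
Variable F : finFieldType.
Implicit Types f g h m : {poly F}.

Lemma sum_monic_split (V : nmodType) n (G : {poly F} -> V) :
  \sum_(g <- polys F n | g \is monic) G g = \sum_(a < n) \sum_(g <- mons F a) G g.
Proof.
elim: n => [|n IH].
  rewrite big_ord0 big1_seq // => g /andP[gm]; rewrite mem_polys leqn0 size_poly_eq0.
  by rewrite (negPf (monic_neq0 gm)).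
rewrite big_ord_recr /= -IH -[LHS]big_filter.
rewrite (_ : _ + _ = \sum_(g <- [seq g <- polys F n | g \is monic] ++ mons F n) G g);
  last by rewrite big_cat /= big_filter.
apply: perm_big; apply: uniq_perm.
- by rewrite filter_uniq ?polys_uniq.
- rewrite cat_uniq mons_uniq filter_uniq ?polys_uniq //= andbT.
  apply/hasPn => g /mem_monsP[gm sg]; rewrite mem_filter gm /= mem_polys sg.
  by rewrite ltnn.
- move=> g; rewrite mem_cat !mem_filter !mem_polys leq_eqVlt ltnS /monic_deg.
  case: (boolP (g \is monic)) => //= gm; have := size_poly_gt0 g.
  rewrite (monic_neq0 gm) /pdeg orbC; case: (size g) => //= k _.
  by rewrite eqSS; case: eqVneq => [->|_]; rewrite ?leqnn ?orbT ?orbF.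
Qed.

Definition divs f := [seq g <- polys F (size f) | (g \is monic) && (g %| f)].

Lemma divs_uniq f : uniq (divs f).
Proof. by rewrite filter_uniq ?polys_uniq. Qed.

Lemma mem_divs f g : f != 0 -> (g \in divs f) = (g \is monic) && (g %| f).
Proof.
move=> f0; rewrite mem_filter mem_polys; case: (boolP (g %| f)) => [gf|]; last first.
  by rewrite andbF.
by rewrite (dvdp_leq f0 gf) !andbT.
Qed.

Lemma tauE f : tau f = size (divs f).
Proof.
rewrite /tau -sum1dep_card -[RHS]sum1_size [RHS]big_filter.
by rewrite (big_npoly _ _ (fun g => (g \is monic) && (g %| f)) (fun=> 1%N)).
Qed.

Lemma sum_factor (V : nmodType) f (G : {poly F} -> {poly F} -> V) : f \is monic ->
  \sum_(g <- polys F (size f) | g \is monic)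
    \sum_(h <- polys F (size f) | (h \is monic) && (g * h == f)) G g h
  = \sum_(g <- divs f) G g (f %/ g).
Proof.
move=> fm; have f0 := monic_neq0 fm.
rewrite /divs big_filter big_mkcondr /= big_seq_cond [RHS]big_seq_cond.
apply: eq_bigr => g /andP[gf gm]; have g0 := monic_neq0 gm.
case: ifP => [gdf|gdf]; last first.
  rewrite big1_seq // => h /andP[/andP[_ /eqP e] _].
  by move: gdf; rewrite -e dvdp_mulr ?dvdpp.
have e : g * (f %/ g) = f by rewrite mulrC divpK.
have qm : f %/ g \is monic by move: fm; rewrite -{1}e monicMl.
rewrite -big_filter (_ : filter _ _ = [:: f %/ g]) ?big_seq1 //.
rewrite -(@filter_pred1_uniq _ (polys F (size f))) ?polys_uniq //; last first.
  by rewrite mem_polys leq_divp.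
apply: eq_filter => h /=; apply/andP/eqP => [[_ /eqP <-]|->]; first by rewrite mulKp.
by rewrite qm e.
Qed.

(** The exact splitting by degrees. It is used for convolutions, for moments of tau, and for writing
    m as conductor times cofactor. *)
Lemma sum_mons_divs (V : nmodType) n (G : {poly F} -> {poly F} -> V) :
  \sum_(f <- mons F n) \sum_(g <- divs f) G g (f %/ g)
  = \sum_(a < n.+1) \sum_(g <- mons F a) \sum_(h <- mons F (n - a)) G g h.
Proof.
transitivity (\sum_(f <- mons F n) \sum_(g <- polys F n.+1 | g \is monic)
   \sum_(h <- polys F n.+1 | h \is monic) if g * h == f then G g h else 0).
  apply: eq_big_seq => f /mem_monsP[fm sf]; rewrite -sum_factor // sf.
  by apply: eq_bigr => g _; rewrite big_mkcondr.
rewrite exchange_big /= sum_monic_split; apply: eq_bigr => a _.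
apply: eq_big_seq => g /mem_monsP[gm sg].
rewrite exchange_big /=.
have an : (a <= n)%N by rewrite -ltnS.
transitivity (\sum_(h <- polys F n.+1 | (h \is monic) && (g * h \in mons F n)) G g h).
  rewrite big_mkcondr /=; apply: eq_bigr => h _; rewrite -big_mkcond /=.
  case: ifP => hn; last first.
    by rewrite big1_seq // => f /andP[/eqP <-]; rewrite hn.
  rewrite -big_filter (_ : filter _ _ = [:: g * h]) ?big_seq1 //.
  rewrite -(filter_pred1_uniq (mons_uniq F n) hn).
  by apply: eq_filter => f; rewrite /= eq_sym.
rewrite -[LHS]big_filter; apply: perm_big; apply: uniq_perm.
- by rewrite filter_uniq ?polys_uniq.
- exact: mons_uniq.
move=> h; rewrite mem_filter mem_polys; apply/andP/mem_monsP.
  move=> [/andP[hm /mem_monsP[_]]]; rewrite size_monicM ?monic_neq0 // sg => e _.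
  by split => //; have := monic_neq0 hm; rewrite -size_poly_gt0; lia.
move=> [hm sh]; rewrite hm sh; split; last by rewrite ltnS leq_subr.
apply/mem_monsP; rewrite monicMl // size_monicM ?monic_neq0 // sg sh; split => //=.
by rewrite addnS subnKC.
Qed.

Lemma mem_divs_self f : f \is monic -> f \in divs f.
Proof. by move=> fm; rewrite mem_divs ?monic_neq0 // fm dvdpp. Qed.

Lemma tau_gt0 f : f \is monic -> (0 < tau f)%N.
Proof. by move=> /mem_divs_self; rewrite tauE; case: (divs f). Qed.

Lemma tau_dvd f g : f != 0 -> g %| f -> (tau g <= tau f)%N.
Proof.
move=> f0 gf; have g0 : g != 0 by apply: contraNneq f0 => g0; rewrite g0 dvd0p in gf.
rewrite !tauE; apply: uniq_leq_size; first exact: divs_uniq.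
by move=> h; rewrite !mem_divs // => /andP[-> /dvdp_trans->].
Qed.

(** [gcdp] is determined only up to a unit; this is its monic representative, which can therefore be
    a member of [divs]. *)
Definition mgcd f g := (lead_coef (gcdp f g))^-1 *: gcdp f g.

Lemma mgcd_eqp f g : f != 0 -> mgcd f g %= gcdp f g.
Proof. by move=> f0; rewrite eqp_scale // invr_eq0 lead_coef_eq0 gcdp_eq0 negb_and f0. Qed.

Lemma mgcd_monic f g : f != 0 -> mgcd f g \is monic.
Proof.
by move=> f0; rewrite monicE lead_coefZ mulVf // lead_coef_eq0 gcdp_eq0 negb_and f0.
Qed.

(** A divisor d of f g factors as d1 (d / d1) with d1 = gcd(d, f). Here d / d1 is coprime to f / d1
    and divides (f / d1) g, hence divides g. *)
Lemma tau_mul f g : f \is monic -> g \is monic -> (tau (f * g) <= tau f * tau g)%N.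
Proof.
move=> fm gm; rewrite !tauE -(size_allpairs *%R).
apply: uniq_leq_size; first exact: divs_uniq.
have f0 := monic_neq0 fm; have g0 := monic_neq0 gm.
move=> d; rewrite mem_divs ?mulf_neq0 // => /andP[dm dfg].
have d0 := monic_neq0 dm; pose d1 := mgcd d f.
have d1m : d1 \is monic := mgcd_monic _ d0.
have d1d : d1 %| d by rewrite (eqp_dvdl _ (mgcd_eqp _ d0)) dvdp_gcdl.
have d1f : d1 %| f by rewrite (eqp_dvdl _ (mgcd_eqp _ d0)) dvdp_gcdr.
have ed : d %/ d1 * d1 = d by rewrite divpK.
have ef : f %/ d1 * d1 = f by rewrite divpK.
apply/allpairsP; exists (d1, d %/ d1); rewrite /= !mem_divs //; split.
- by rewrite d1m.
- have -> : d %/ d1 \is monic by move: dm; rewrite -{1}ed monicMr.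
  have cop : coprimep (d %/ d1) (f %/ d1).
    have : d1 %= gcdp (d %/ d1 * d1) (f %/ d1 * d1) by rewrite ed ef mgcd_eqp.
    move=> /eqp_trans/(_ (gcdp_mul2r _ _ _)); rewrite -[X in X %= _]mul1r.
    by rewrite eqp_mul2r ?monic_neq0 // eqp_sym /coprimep -size_poly_eq1.
  rewrite -(Gauss_dvdpr _ cop) -(@dvdp_mul2r _ d1) ?monic_neq0 // ed.
  by rewrite mulrAC ef.
- by rewrite mulrC ed.
Qed.

(** Induction on k: one factor tau(f) is opened as a sum over f = g h, and tau(g h) <= tau(g) tau(h)
    separates the variables. The exponent x becomes 2x + 1, whence 2^k - 1. *)
Lemma tau_moment (R : numDomainType) k n :
  \sum_(f <- mons F n) (tau f)%:R ^+ k
  <= #|F|%:R ^+ n * n.+1%:R ^+ (2 ^ k).-1 :> R.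
Proof.
elim: k n => [|k IH] n.
  by rewrite (eq_bigr (fun=> 1)) // sum_const_seq size_mons // mulr1 natrX.
have -> : \sum_(f <- mons F n) (tau f)%:R ^+ k.+1 =
  \sum_(f <- mons F n) \sum_(g <- divs f) (tau (g * (f %/ g)))%:R ^+ k :> R.
  apply: eq_big_seq => f /mem_monsP[fm _].
  rewrite exprS {1}tauE -sum1_size natr_sum big_distrl /=.
  apply: eq_big_seq => g; rewrite mem_divs ?monic_neq0 // => /andP[_ gf].
  by rewrite mul1r mulrC divpK.
rewrite (sum_mons_divs n (fun g h => (tau (g * h))%:R ^+ k)).
apply: (@le_trans _ _ (\sum_(a < n.+1) (\sum_(g <- mons F a) (tau g)%:R ^+ k) *
   (\sum_(h <- mons F (n - a)) (tau h)%:R ^+ k))).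
  apply: ler_sum => a _; rewrite big_distrl /= big_seq [leRHS]big_seq.
  apply: ler_sum => g /mem_monsP[gm _]; rewrite big_distrr /= big_seq [leRHS]big_seq.
  apply: ler_sum => h /mem_monsP[hm _]; rewrite -exprMn lerXn2r ?nnegrE ?mulr_ge0 //.
  by rewrite -natrM ler_nat tau_mul.
apply: (@le_trans _ _ (\sum_(a < n.+1) #|F|%:R ^+ n * n.+1%:R ^+ ((2 ^ k).-1 * 2))).
  apply: ler_sum => a _; have an : (a <= n)%N by rewrite -ltnS.
  apply: le_trans (ler_pM _ _ (IH a) (IH (n - a)%N)) _.
  - by apply: sumr_ge0 => g _; rewrite exprn_ge0.
  - by apply: sumr_ge0 => g _; rewrite exprn_ge0.
  rewrite mulrACA -exprD subnKC // ler_wpM2l ?exprn_ge0 // exprM expr2.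
  by rewrite ler_pM ?exprn_ge0 // lerXn2r ?nnegrE // ler_nat ltnS // leq_subr.
rewrite sumr_const card_ord -[leLHS]mulr_natr -mulrA -exprSr.
by rewrite (_ : (_ * _).+1 = (2 ^ k.+1).-1)%N // expnS; have := expn_gt0 2 k; lia.
Qed.
End Divisors.

(** * Residue classes and the totient *)

Section Residues.
Variable F : finFieldType.
Implicit Types d e f g h m r u : {poly F}.

Lemma modp_eqE m f g : (f %% m == g %% m) = (m %| f - g).
Proof. by rewrite /dvdp modpD modpN subr_eq0. Qed.

Lemma coprimep_congr m f g : f %% m = g %% m -> coprimep f m = coprimep g m.
Proof. by move=> e; rewrite -(coprimep_modl f) e coprimep_modl. Qed.

Lemma pdegE m : m != 0 -> (pdeg m).+1 = size m.
Proof. by move=> m0; rewrite prednK // size_poly_gt0. Qed.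

Lemma size_modp_pdeg m f : m != 0 -> (size (f %% m)%R <= pdeg m)%N.
Proof. by move=> m0; rewrite -ltnS pdegE // ltn_modp. Qed.

Lemma pdegM f g : f != 0 -> g != 0 -> pdeg (f * g) = (pdeg f + pdeg g)%N.
Proof. by move=> f0 g0; rewrite /pdeg size_mul // -(pdegE f0) -(pdegE g0) /= addnS. Qed.

Lemma coprimep_inv m f : m != 0 -> coprimep f m ->
  exists g, [/\ (size g <= pdeg m)%N, coprimep g m & (f * g) %% m = 1 %% m].
Proof.
move=> m0 /Bezout_eq1_coprimepP[[x y] /= e].
have e1 : (f * (x %% m)) %% m = 1 %% m.
  by rewrite modp_mul -e modpD modp_mull addr0 mulrC.
exists (x %% m); split => //; first exact: size_modp_pdeg.
rewrite coprimep_modl; apply/Bezout_eq1_coprimepP; exists (f, y) => /=.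
by rewrite -e mulrC.
Qed.

(** Units mod e lift to units mod m. Let k be the part of m coprime to e and solve u = r mod e, u =
    1 mod k; since m divides k times a power of e, u is coprime to m. *)
Lemma lift_coprime e m r : m != 0 -> e %| m -> coprimep r e ->
  exists2 u, u %% e = r %% e & coprimep u m.
Proof.
move=> m0 em cre; have e0 : e != 0 by apply: contraNneq m0 => e0; rewrite -dvd0p -e0.
pose k := gdcop e m.
have cke : coprimep k e by exact: coprimep_gdco.
case/Bezout_eq1_coprimepP: (cke) => -[x y] /= exy.
pose u := r * (x * k) + y * e.
have ue : u %% e = r %% e.
  apply/eqP; rewrite modp_eqE /u (_ : _ - r = (y - r * y) * e) ?dvdp_mull //.
  by rewrite -{2}[r]mulr1 -exy; ring.
have uk : u %% k = 1 %% k.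
  apply/eqP; rewrite modp_eqE /u -exy (_ : _ - _ = (r * x - x) * k) ?dvdp_mull //.
  by ring.
exists u => //; apply: coprimep_dvdl (dvdp_gdcor m e0) _.
rewrite coprimepMr (coprimep_congr uk) coprime1p coprimep_expr //.
by rewrite (coprimep_congr ue).
Qed.

Lemma chinese_gcd d1 d2 f : gcdp d1 d2 %| f - 1 ->
  exists2 g, g %% d1 = f %% d1 & g %% d2 = 1 %% d2.
Proof.
have [[x y] /= exy] := Bezoutp d1 d2.
rewrite -(eqp_dvdl _ exy) => /dvdpP[k ek].
exists (f - k * x * d1); apply/eqP; rewrite modp_eqE.
  by rewrite addrAC subrr add0r dvdpNr dvdp_mull.
have -> : f - k * x * d1 - 1 = k * y * d2 by rewrite addrAC ek; ring.
by rewrite dvdp_mull.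
Qed.

Definition resid m := [seq r <- polys F (pdeg m) | coprimep r m].

Lemma mem_resid m r : (r \in resid m) = (size r <= pdeg m)%N && coprimep r m.
Proof. by rewrite mem_filter mem_polys andbC. Qed.

Lemma resid_uniq m : uniq (resid m).
Proof. by rewrite filter_uniq ?polys_uniq. Qed.

Lemma phiE m : m != 0 -> phi m = size (resid m).
Proof.
move=> m0; rewrite /phi -sum1dep_card -[RHS]sum1_size [RHS]big_filter.
rewrite -(big_npoly _ _ (fun r => coprimep r m) (fun=> 1%N)).
apply: eq_bigl => r; apply/existsP/idP => [[s]|].
  rewrite modp_eqE => /dvdpP[k ek]; apply/Bezout_eq1_coprimepP.
  by exists (val s, - k) => /=; rewrite mulNr -ek; ring.
move=> /(coprimep_inv m0)[g [sg _ e]]; exists (npolyp _ g).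
by rewrite npolypK // e.
Qed.

Lemma modp_in_resid m f : m != 0 -> coprimep f m -> f %% m \in resid m.
Proof. by move=> m0 cf; rewrite mem_resid size_modp_pdeg // coprimep_modl. Qed.

Lemma phi_gt0 m : m != 0 -> (0 < phi m)%N.
Proof.
move=> m0; rewrite phiE //; have := modp_in_resid m0 (coprime1p m).
by case: (resid m).
Qed.

Lemma natr_count (R : pzSemiRingType) (I : Type) (s : seq I) (P : pred I) :
  (count P s)%:R = \sum_(i <- s) (P i)%:R :> R.
Proof. by rewrite -sum1_count natr_sum big_mkcond; apply: eq_bigr => i _; case: (P i). Qed.

Lemma count_polys_mod n m (P : pred {poly F}) : m != 0 -> (pdeg m <= n)%N ->
  count (fun f => P (f %% m)) (polys F n)
  = (count P (polys F (pdeg m)) * #|F| ^ (n - pdeg m))%N.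
Proof.
move=> m0 mn; apply/eqP; rewrite -(eqr_nat int) natr_count.
by rewrite (sum_polys_mod (fun r => (P r)%:R : int)) // -natr_count natrM mulr_natr.
Qed.

(** The left side counts the residues r mod d e that are coprime to d. Each is g u mod d e with g =
    gcd(e, r) and u a unit mod d e: r / g is a unit mod d (e / g), it lifts to u, and multiplying
    the congruence by g restores the modulus d e. There are at most tau(e) phi(d e) pairs (g, u). *)
Lemma phi_mul_ge d e : d \is monic -> e \is monic ->
  (#|F| ^ pdeg e * phi d <= tau e * phi (d * e))%N.
Proof.
move=> dm em; have d0 := monic_neq0 dm; have e0 := monic_neq0 em.
have m0 : d * e != 0 by rewrite mulf_neq0.
set m := d * e in m0 *.
have dlem : (pdeg d <= pdeg m)%N by rewrite pdegM // leq_addr.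
have -> : (#|F| ^ pdeg e * phi d)%N = size [seq r <- polys F (pdeg m) | coprimep r d].
  rewrite phiE // !size_filter mulnC (_ : pdeg e = (pdeg m - pdeg d)%N).
    rewrite -count_polys_mod //; apply: eq_count => r /=.
    by rewrite coprimep_modl.
  by rewrite pdegM // addKn.
rewrite tauE (phiE m0) -(size_allpairs (fun g u => (g * u) %% m)).
apply: uniq_leq_size; first by rewrite filter_uniq ?polys_uniq.
move=> r; rewrite mem_filter mem_polys => /andP[crd sr].
pose g := mgcd e r; have gm : g \is monic := mgcd_monic _ e0.
have g0 := monic_neq0 gm.
have ge : g %| e by rewrite (eqp_dvdl _ (mgcd_eqp _ e0)) dvdp_gcdl.
have gr : g %| r by rewrite (eqp_dvdl _ (mgcd_eqp _ e0)) dvdp_gcdr.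
have ee : e %/ g * g = e by rewrite divpK.
have er : r %/ g * g = r by rewrite divpK.
have cop : coprimep (r %/ g) (e %/ g).
  have : g %= gcdp (e %/ g * g) (r %/ g * g) by rewrite ee er mgcd_eqp.
  move=> /eqp_trans/(_ (gcdp_mul2r _ _ _)); rewrite -[X in X %= _]mul1r.
  by rewrite eqp_mul2r // eqp_sym coprimep_sym /coprimep -size_poly_eq1.
have cop2 : coprimep (r %/ g) (d * (e %/ g)).
  by rewrite coprimepMr cop andbT; apply: coprimep_dvdr crd; rewrite -{2}er dvdp_mulr.
have [|u eu cu] := lift_coprime m0 _ cop2.
  by rewrite /m dvdp_mul2l // -{2}ee dvdp_mulr.
apply/allpairsP; exists (g, u %% m); rewrite /= mem_divs // gm ge modp_in_resid //.
split => //; rewrite modp_mul.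
have : m %| g * u - r.
  have := modp_eqE (d * (e %/ g)) u (r %/ g); rewrite eu eqxx => /esym.
  rewrite -(@dvdp_mul2r _ g) // mulrBl er -mulrA ee.
  by rewrite [u * g]mulrC.
rewrite -modp_eqE => /eqP ->; rewrite modp_small // -(pdegE m0) ltnS //.
Qed.

Lemma inv_phi_mul_le (R : numFieldType) d e : d \is monic -> e \is monic ->
  (phi (d * e))%:R^-1 <= (tau e)%:R / #|F|%:R ^+ pdeg e / (phi d)%:R :> R.
Proof.
move=> dm em; have d0 := monic_neq0 dm; have e0 := monic_neq0 em.
have q0 : (0 < #|F|)%N := ltnW (finNzRing_gt1 F).
rewrite -mulrA -invfM ler_pdivlMr ?mulr_gt0 ?exprn_gt0 ?ltr0n ?phi_gt0 //.
rewrite mulrC ler_pdivrMr ?ltr0n ?phi_gt0 ?mulf_neq0 //.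
by rewrite -natrX -!natrM ler_nat phi_mul_ge.
Qed.
End Residues.

(** * Existence of the characters *)

Lemma closed_prim_root (C : closedFieldType) n : n%:R != 0 :> C ->
  exists z : C, n.-primitive_root z.
Proof.
move=> nn0; have n_gt0 : (0 < n)%N by case: n nn0 => //; rewrite eqxx.
pose p : {poly C} := 'X^n - 1; have [r Dp] := closed_field_poly_normal p.
rewrite (monicP _) ?monicXnsubC // scale1r in Dp.
have rn1 : all n.-unity_root r by apply/allP=> z; rewrite -root_prod_XsubC -Dp.
have sz_r : (n < (size r).+1)%N by rewrite -(size_prod_XsubC r id) -Dp size_XnsubC.
have [|z] := hasP (has_prim_root n_gt0 rn1 _ sz_r); last by exists z.
by rewrite -separable_prod_XsubC -Dp separable_Xn_sub_1.
Qed.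

(* The irreducible characters of a finite abelian group are linear, and their *)
(* values are roots of unity, which can be moved from algC to C.              *)
Lemma abelian_dual (C : numClosedFieldType) (gT : finGroupType) (G : {group gT}) :
  abelian G -> exists X : 'I_#|G| -> gT -> C,
  [/\ forall i, X i 1%g = 1,
      forall i x y, x \in G -> y \in G -> X i (x * y)%g = X i x * X i y &
      forall i j, (forall x, x \in G -> X i x = X j x) -> i = j].
Proof.
move=> abG; have n_gt0 := cardG_gt0 G; set n := #|G| in n_gt0 *.
have [z zP] := C_prim_root_exists n_gt0.
have [w wP] : exists w : C, n.-primitive_root w.
  by apply: closed_prim_root; rewrite pnatr_eq0 -lt0n.
pose T (x : algC) : C := w ^+ odflt (Ordinal n_gt0) [pick k : 'I_n | x == z ^+ k].
have TE k : T (z ^+ k) = w ^+ k.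
  rewrite /T; case: pickP => [j|/(_ (Ordinal (ltn_pmod k n_gt0)))] /=.
    by rewrite (eq_prim_root_expr zP) => e; apply/eqP; rewrite (eq_prim_root_expr wP) eq_sym.
  by rewrite (eq_prim_root_expr zP) modn_mod eqxx.
have eN : n = Nirr G by rewrite NirrE; apply/esym/eqP; rewrite -card_classes_abelian.
pose chi (i : 'I_n) := 'chi[G]_(cast_ord eN i).
have lchi i : chi i \is a linear_char by apply/char_abelianP.
have chiz i x : x \in G -> {k : 'I_n | chi i x = z ^+ k}.
  move=> xG; apply: (prim_rootP zP).
  have [k ek] := dvdnP (order_dvdG xG).
  by rewrite -/n in ek; rewrite ek mulnC exprM lin_char_unity_root // expr1n.
exists (fun i x => T (chi i x)); split.
- by move=> i; rewrite lin_char1 // -(expr0 z) TE.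
- move=> i x y xG yG; rewrite lin_charM //.
  by have [k ->] := chiz i x xG; have [l ->] := chiz i y yG; rewrite -exprD !TE exprD.
move=> i j e; apply: (@cast_ord_inj _ _ eN); apply: irr_inj; apply/cfun_inP => x xG.
have := e x xG; rewrite -/(chi i) -/(chi j).
have [k ->] := chiz i x xG; have [l ->] := chiz j x xG; rewrite !TE => /eqP.
by rewrite (eq_prim_root_expr wP) -(eq_prim_root_expr zP) => /eqP.
Qed.

Section CharacterFamily.
Variables (R : realType) (F : finFieldType).
Implicit Types (f g m : {poly F}).

Lemma character_family_exists m : m \is monic ->
  exists chi : nat -> {poly F} -> R[i],
    (forall i, (i < phi m)%N -> character_mod m (chi i)) /\
    (forall i j, (i < phi m)%N -> (j < phi m)%N ->
       (forall f, coprimep f m -> chi i f = chi j f) -> i = j).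
Proof.
move=> mm; have m0 := monic_neq0 mm.
(* The quotient type replaces a constant modulus by X, so m = 1 is treated by hand. *)
have [m1|m1] := leqP (size m) 1.
  have em : m = 1.
    apply/eqP; rewrite -(eqp_monic mm (monic1 _)) -size_poly_eq1 eqn_leq m1.
    by rewrite size_poly_gt0.
  have phi1 : phi m = 1%N.
    apply/eqP; rewrite eqn_leq phi_gt0 // andbT phiE // (leq_trans (size_subseq (filter_subseq _ _))) //.
    by rewrite size_polys /pdeg em size_poly1 /= expn0.
  exists (fun _ _ => 1); split.
    move=> i _; split => //; last by move=> *; rewrite mulr1.
    by move=> f; rewrite em coprimep1.
  by move=> [|i] [|j]; rewrite phi1.
pose U := {unit {poly %/ m}}; pose G : {group U} := [set: U]%G.
have abG : abelian G by apply/centsP => x _ y _; apply: val_inj; rewrite /= mulrC.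
have [X [X1 XM Xinj]] := abelian_dual (R[i] : numClosedFieldType) abG.
have mkm : mk_monic m = m by rewrite /mk_monic m1 mm.
have modE f : val (in_qpoly m f) = f %% m.
  by rewrite /= -Pdiv.IdomainMonic.modpE ?monic_mk_monic // mkm.
(* Non-units get the default value 1; the characters built below test coprimality first, so this
   value never shows. *)
pose u f : U := insubd (1%g : U) (in_qpoly m f).
have uE f : coprimep f m -> val (u f) = in_qpoly m f.
  move=> cf; apply: insubdK.
  change (is_true (coprimep (mk_monic m) (val (in_qpoly m f)))).
  by rewrite modE mkm coprimep_sym coprimep_modl.
have uM f g : coprimep f m -> coprimep g m -> u (f * g) = (u f * u g)%g.
  move=> cf cg; apply: val_inj; rewrite /= !uE ?coprimepMl ?cf //.
  by rewrite in_qpolyM.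
have usurj (x : U) : exists2 f, coprimep f m & u f = x.
  have : is_true (coprimep (mk_monic m) (val (val x))) by exact: valP x.
  rewrite (_ : forall p, coprimep (mk_monic m) p = coprimep p m); last first.
    by move=> p; rewrite mkm coprimep_sym.
  move=> cx.
  exists (val (val x)) => //; apply: val_inj; rewrite uE //.
  apply: val_inj; rewrite modE modp_small //.
  by apply: leq_trans (size_mk_monic _) _; rewrite mkm.
have phiG : (phi m <= #|G|)%N.
  rewrite phiE // cardsT cardE -(size_map u); apply: uniq_leq_size; last first.
    by move=> x _; rewrite mem_enum.
  rewrite map_inj_in_uniq ?resid_uniq // => f g; rewrite !mem_resid.
  move=> /andP[sf cf] /andP[sg cg] e.
  have := congr1 (fun x : U => val (val x)) e; rewrite !uE // !modE.
  by rewrite !modp_small // -(pdegE m0) ltnS.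
have G0 := cardG_gt0 G.
(* The reduction only serves to accept natural indices; it is the identity below [phi m], which is
   at most [#|G|]. *)
pose ii k : 'I_#|G| := Ordinal (ltn_pmod k G0).
exists (fun i f => if coprimep f m then X (ii i) (u f) else 0); split.
  move=> i _; split.
  - by move=> f /negPf ->.
  - move=> f; rewrite coprimep_modl; case: ifP => // cf; congr (X _ _).
    by apply: val_inj; rewrite !uE ?coprimep_modl //; apply: val_inj; rewrite !modE modp_id.
  - rewrite coprime1p (_ : u 1 = 1%g) ?X1 //; apply: val_inj.
    by rewrite uE ?coprime1p // in_qpoly1.
  - by move=> f g cf cg; rewrite coprimepMl cf cg /= uM // XM // inE.
move=> i j im jm e.
have : ii i = ii j.
  apply: Xinj => x _; have [f cf <-] := usurj x.
  by have := e f cf; rewrite cf.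
by move/(congr1 val); rewrite /= !modn_small // (leq_trans _ phiG).
Qed.
End CharacterFamily.

(** * Orthogonality *)

Section Bessel.
Variable C : numClosedFieldType.
Local Notation "x ^*" := (Num.conj x).

(** The squared norm of a minus its orthogonal projection is nonnegative. The pairing with v_i
    carries no conjugate, so the projection is onto the span of the conjugates of the v_i. *)
Lemma bessel (X : Type) (s : seq X) (I : eqType) (J : seq I) (v : I -> X -> C)
    (w : I -> C) (a : X -> C) :
  uniq J -> (forall i, i \in J -> 0 < w i) ->
  (forall i j, i \in J -> j \in J ->
     \sum_(x <- s) v i x * (v j x)^* = if i == j then w i else 0) ->
  \sum_(i <- J) `|\sum_(x <- s) a x * v i x| ^+ 2 / w i
  <= \sum_(x <- s) `|a x| ^+ 2.
Proof.
move=> uJ w0 orth.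
pose c i := \sum_(x <- s) a x * v i x.
pose k i := c i / w i.
pose S := \sum_(i <- J) k i * (c i)^*.
have kwc i : i \in J -> k i * w i = c i.
  by move=> iJ; rewrite /k divfK // gt_eqF ?w0.
have -> : \sum_(i <- J) `|\sum_(x <- s) a x * v i x| ^+ 2 / w i = S.
  by apply: eq_bigr => i _; rewrite normCK /k -/(c i) mulrAC.
have -> : \sum_(x <- s) `|a x| ^+ 2 = \sum_(x <- s) a x * (a x)^*.
  by apply: eq_bigr => x _; rewrite normCK.
pose b x := a x - \sum_(i <- J) k i * (v i x)^*.
have h0 : 0 <= \sum_(x <- s) b x * (b x)^*.
  by apply: sumr_ge0 => x _; rewrite -normCK exprn_ge0.
rewrite -subr_ge0; suff <- : \sum_(x <- s) b x * (b x)^* =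
   \sum_(x <- s) a x * (a x)^* - S by [].
have e1 : \sum_(x <- s) a x * (\sum_(i <- J) k i * (v i x)^*)^* = S^*.
  rewrite (eq_bigr (fun x => \sum_(i <- J) a x * ((k i)^* * v i x))); last first.
    move=> x _; rewrite rmorph_sum big_distrr /=; apply: eq_bigr => i _.
    by rewrite rmorphM /= conjCK.
  rewrite exchange_big /= /S rmorph_sum; apply: eq_bigr => i _.
  rewrite rmorphM /= conjCK /c big_distrr /=; apply: eq_bigr => x _.
  by rewrite mulrCA.
have e2 : \sum_(x <- s) (\sum_(i <- J) k i * (v i x)^*) * (a x)^* = S.
  rewrite (eq_bigr (fun x => \sum_(i <- J) k i * ((v i x)^* * (a x)^*))); last first.
    by move=> x _; rewrite big_distrl /=; apply: eq_bigr => i _; rewrite mulrA.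
  rewrite exchange_big /= /S; apply: eq_bigr => i _; rewrite -big_distrr /=.
  congr (_ * _); rewrite /c rmorph_sum /=; apply: eq_bigr => x _.
  by rewrite rmorphM mulrC.
have e3 : \sum_(x <- s) (\sum_(i <- J) k i * (v i x)^*) *
    (\sum_(i <- J) k i * (v i x)^*)^* = S^*.
  transitivity (\sum_(x <- s) \sum_(i <- J) \sum_(j <- J)
     (k i * (k j)^*) * (v j x * (v i x)^*)).
    apply: eq_bigr => x _; rewrite big_distrl /=; apply: eq_bigr => i _.
    rewrite rmorph_sum big_distrr /=; apply: eq_bigr => j _.
    by rewrite rmorphM /= conjCK; ring.
  rewrite exchange_big /= /S rmorph_sum /=; apply: eq_big_seq => i iJ.
  rewrite exchange_big /= (bigD1_seq i) //= [X in _ + X]big1_seq ?addr0; last first.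
    move=> j /andP[ji jJ]; rewrite -big_distrr /= orth //.
    by rewrite (negPf ji) mulr0.
  rewrite -big_distrr /= orth // eqxx [RHS]rmorphM /= conjCK mulrAC kwc //.
  by rewrite mulrC.
rewrite (eq_bigr (fun x => a x * (a x)^* - a x * (\sum_(i <- J) k i * (v i x)^*)^*
   - (\sum_(i <- J) k i * (v i x)^*) * (a x)^*
   + (\sum_(i <- J) k i * (v i x)^*) * (\sum_(i <- J) k i * (v i x)^*)^*)); last first.
  by move=> x _; rewrite /b rmorphB /=; ring.
rewrite big_split /= !sumrB e1 e2 e3; ring.
Qed.
End Bessel.

(** * The real-valued modulus of a complex number *)

Section ComplexModulus.
Variable R : realType.
Local Notation C := (R[i]).
Local Notation normc := Normc.normc.

Lemma normcE (x : C) : `|x| = (normc x)%:C.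
Proof. by []. Qed.

Lemma normc_ge0 (x : C) : 0 <= normc x.
Proof. by rewrite -lecR; exact: (normr_ge0 x). Qed.

Lemma normc_sum (I : Type) (s : seq I) (P : pred I) (G : I -> C) :
  normc (\sum_(i <- s | P i) G i) <= \sum_(i <- s | P i) normc (G i).
Proof.
elim/big_rec2: _ => [|i x y _ h]; first by rewrite Normc.normc0.
by apply: le_trans (le_normcD _ _) _; rewrite lerD2l.
Qed.

Lemma normc_conj (x : C) : normc (Num.conj x) = normc x.
Proof. by apply: complexI; rewrite -!normcE norm_conjC. Qed.

Lemma normc_nat n : normc (n%:R : C) = n%:R.
Proof. by apply: complexI; rewrite -normcE normr_nat rmorph_nat. Qed.
End ComplexModulus.

(** * Characters: absolute values and the first orthogonality relation *)

Section Characters.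
Variables (R : realType) (F : finFieldType).
Implicit Types (f g m d : {poly F}) (chi : {poly F} -> R[i]).
Local Notation C := (R[i]).
Local Notation normc := Normc.normc.
Local Notation "x ^*" := (Num.conj x).

Lemma perm_polys_mulmod m u : m != 0 -> coprimep u m ->
  perm_eq [seq (u * r) %% m | r <- polys F (pdeg m)] (polys F (pdeg m)).
Proof.
move=> m0 cu.
have us : uniq [seq (u * r) %% m | r <- polys F (pdeg m)].
  rewrite map_inj_in_uniq ?polys_uniq // => r r'; rewrite !mem_polys => sr sr' /eqP.
  rewrite modp_eqE -mulrBr Gauss_dvdpr 1?coprimep_sym // -modp_eqE.
  by rewrite !modp_small -?(pdegE m0) ?ltnS // => /eqP.
apply: uniq_perm; rewrite ?polys_uniq //.
have sub : {subset [seq (u * r) %% m | r <- polys F (pdeg m)] <= polys F (pdeg m)}.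
  by move=> _ /mapP[r _ ->]; rewrite mem_polys size_modp_pdeg.
by have [] := uniq_min_size us sub _; rewrite ?size_map.
Qed.

Lemma char_modE m chi f g : character_mod m chi -> f %% m = g %% m -> chi f = chi g.
Proof. by case=> _ h _ _ e; rewrite (h f) (h g) e. Qed.

Lemma char_ncop m chi f : character_mod m chi -> ~~ coprimep f m -> chi f = 0.
Proof. by case=> h _ _ _; exact: h. Qed.

Lemma charM m chi f g : character_mod m chi -> chi (f * g) = chi f * chi g.
Proof.
move=> ch; have [cf|cf] := boolP (coprimep f m); last first.
  by rewrite (char_ncop ch cf) mul0r (char_ncop ch) // coprimepMl (negPf cf).
have [cg|cg] := boolP (coprimep g m); last first.
  by rewrite (char_ncop ch cg) mulr0 (char_ncop ch) // coprimepMl (negPf cg) andbF.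
by case: ch => _ _ _; apply.
Qed.

Lemma char_shift (V : nmodType) m chi (G : C -> V) u : m != 0 ->
  character_mod m chi -> coprimep u m ->
  \sum_(r <- polys F (pdeg m)) G (chi u * chi r) = \sum_(r <- polys F (pdeg m)) G (chi r).
Proof.
move=> m0 ch cu; rewrite -[RHS](perm_big _ (perm_polys_mulmod m0 cu)) [RHS]big_map /=.
by apply: eq_bigr => r _; rewrite -(charM _ _ ch) (char_modE ch (modp_id _ _)).
Qed.

(** Multiplication by f permutes the residues, so the sum of |chi(r)| over them equals |chi(f)|
    times itself; that sum is nonzero because chi(1) = 1. *)
Lemma char_norm m chi f : m != 0 -> character_mod m chi -> coprimep f m ->
  normc (chi f) = 1.
Proof.
move=> m0 ch cf; set s := polys F (pdeg m).
have := char_shift (fun x => normc x) m0 ch cf.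
rewrite (eq_bigr (fun r => normc (chi f) * normc (chi r))); last first.
  by move=> r _; rewrite Normc.normcM.
rewrite -big_distrr /= => /eqP; rewrite -[X in _ == X]mul1r -subr_eq0 -mulrBl mulf_eq0.
case/orP; first by rewrite subr_eq0 => /eqP.
rewrite psumr_eq0; last by move=> *; exact: normc_ge0.
have i1 : 1 %% m \in s by rewrite mem_polys size_modp_pdeg.
move=> /allP/(_ _ i1) /=; have [_ h1 h2 _] := ch.
by rewrite -h1 h2 Normc.normc1 oner_eq0.
Qed.

Lemma char_norm_le1 m chi f : m != 0 -> character_mod m chi -> normc (chi f) <= 1.
Proof.
move=> m0 ch; have [cf|cf] := boolP (coprimep f m); first by rewrite (char_norm m0 ch).
by rewrite (char_ncop ch cf) Normc.normc0.
Qed.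

Lemma char_mul_conj m chi f : m != 0 -> character_mod m chi ->
  chi f * (chi f)^* = (coprimep f m)%:R.
Proof.
move=> m0 ch; rewrite -normCK normcE.
have [cf|cf] := boolP (coprimep f m); first by rewrite (char_norm m0 ch) // expr1n.
by rewrite (char_ncop ch cf) Normc.normc0 expr0n.
Qed.

Lemma char_sum0 m chi u : m != 0 -> character_mod m chi -> coprimep u m ->
  chi u != 1 -> \sum_(r <- polys F (pdeg m)) chi r = 0.
Proof.
move=> m0 ch cu u1; have := char_shift id m0 ch cu; rewrite -big_distrr /= => /eqP.
rewrite -[X in _ == X]mul1r -subr_eq0 -mulrBl mulf_eq0 subr_eq0 (negPf u1).
by move=> /eqP.
Qed.

Lemma modp_dvd m d f : d %| m -> (f %% m) %% d = f %% d.
Proof.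
move=> dm; apply/eqP; rewrite modp_eqE; apply: dvdp_trans dm _.
by rewrite -modp_eqE modp_id.
Qed.

Lemma char_mul m m' chi chi' : character_mod m chi -> character_mod m' chi' ->
  character_mod (m * m') (fun f => chi f * (chi' f)^*).
Proof.
move=> ch ch'; split.
- move=> f; rewrite coprimepMr negb_and => /orP[] h.
    by rewrite (char_ncop ch h) mul0r.
  by rewrite (char_ncop ch' h) conjC0 mulr0.
- move=> f; congr (_ * Num.conj _).
    by apply: (char_modE ch); rewrite modp_dvd ?dvdp_mulr.
  by apply: (char_modE ch'); rewrite modp_dvd ?dvdp_mull.
- by case: ch => _ _ -> _; case: ch' => _ _ -> _; rewrite conjC1 mulr1.
- by move=> f g _ _; rewrite (charM _ _ ch) (charM _ _ ch') rmorphM /= mulrACA.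
Qed.

Lemma char_orth L m m' chi chi' u : m != 0 -> m' != 0 ->
  character_mod m chi -> character_mod m' chi' -> (pdeg m + pdeg m' <= L)%N ->
  coprimep u m -> coprimep u m' -> chi u != chi' u ->
  \sum_(f <- polys F L) chi f * (chi' f)^* = 0.
Proof.
move=> m0 m0' ch ch' mL cu cu' ne; have eta := char_mul ch ch'.
have M0 : m * m' != 0 by rewrite mulf_neq0.
rewrite (eq_bigr (fun f => chi (f %% (m * m')) * (chi' (f %% (m * m')))^*)); last first.
  by move=> f _; exact: (char_modE eta (esym (modp_id f _))).
rewrite (sum_polys_mod (fun f => chi f * (chi' f)^*)) ?pdegM //.
rewrite -pdegM // (char_sum0 M0 eta (u := u)) ?mul0rn ?coprimepMr ?cu //.
apply: contraNneq ne => e; apply/eqP.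
have nz : chi' u * (chi' u)^* = 1 by rewrite (char_mul_conj _ m0' ch') cu'.
have nz' : (chi' u)^* != 0 by apply/eqP => z; move/eqP: nz; rewrite z mulr0 eq_sym oner_eq0.
by apply: (mulIf nz'); rewrite e nz.
Qed.

Lemma char_norm2 L m chi : m != 0 -> character_mod m chi -> (pdeg m <= L)%N ->
  \sum_(f <- polys F L) chi f * (chi f)^* = (phi m * #|F| ^ (L - pdeg m))%:R.
Proof.
move=> m0 ch mL; rewrite (eq_bigr (fun f => (coprimep (f %% m) m)%:R)); last first.
  by move=> f _; rewrite (char_mul_conj _ m0 ch) coprimep_modl.
rewrite -(natr_count C _ (fun f => coprimep (f %% m) m)).
by rewrite (count_polys_mod (fun f => coprimep f m)) // phiE // size_filter.
Qed.

(** For equal moduli one period has length deg m only; the sum over degree < 2 deg m given by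
    [char_orth] is q^(deg m) copies of it. *)
Lemma char_orth_mod m chi chi' u : m != 0 ->
  character_mod m chi -> character_mod m chi' -> coprimep u m -> chi u != chi' u ->
  \sum_(f <- polys F (pdeg m)) chi f * (chi' f)^* = 0.
Proof.
move=> m0 ch ch' cu ne; have := char_orth m0 m0 ch ch' (leqnn _) cu cu ne.
rewrite (eq_bigr (fun f => chi (f %% m) * (chi' (f %% m))^*)); last first.
  by move=> f _; rewrite !(char_modE ch (modp_id f _)) !(char_modE ch' (modp_id f _)).
rewrite (sum_polys_mod (fun f => chi f * (chi' f)^*)) ?leq_addr // => /eqP.
rewrite mulrn_eq0 expn_eq0 => /orP[/andP[]|/eqP //].
by rewrite -leqn0 leqNgt (ltnW (finNzRing_gt1 F)).
Qed.
End Characters.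

(** * Conductors and the large sieve *)

Section DualGroup.
Variables (R : realType) (F : finFieldType).
Implicit Types (f g m d e : {poly F}) (chi : {poly F} -> R[i]).
Local Notation C := (R[i]).
Local Notation normc := Normc.normc.
Local Notation "x ^*" := (Num.conj x).

(** A fixed choice of phi(m) distinct characters mod m, shown by [dchar_complete] to be all of them.
    Natural-number indices let pairs (modulus, index) with varying modulus live in one type. *)
Definition dchar m : nat -> {poly F} -> C :=
  match pselect (m \is monic) with
  | left h => sval (cid (character_family_exists R h))
  | right _ => fun _ _ => 0
  end.

Lemma dcharP m : m \is monic ->
  (forall i, (i < phi m)%N -> character_mod m (dchar m i)) /\
  (forall i j, (i < phi m)%N -> (j < phi m)%N ->
     (forall f, coprimep f m -> dchar m i f = dchar m j f) -> i = j).
Proof. by rewrite /dchar => mm; case: pselect => // h; case: cid. Qed.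

Lemma dchar_char m i : m \is monic -> (i < phi m)%N -> character_mod m (dchar m i).
Proof. by move=> /dcharP[h _]; exact: h. Qed.

Lemma dchar_inj m i j : m \is monic -> (i < phi m)%N -> (j < phi m)%N ->
  (forall f, coprimep f m -> dchar m i f = dchar m j f) -> i = j.
Proof. by move=> /dcharP[_ h]; exact: h. Qed.

Lemma char_neq m chi chi' : character_mod m chi -> character_mod m chi' ->
  chi <> chi' -> exists2 u, coprimep u m & chi u != chi' u.
Proof.
move=> ch ch' ne; apply: contrapT => h; apply: ne; apply: funext => f.
have [cf|cf] := boolP (coprimep f m); last by rewrite !(char_ncop _ cf).
by apply/eqP/negP => n; apply: h; exists f => //; apply/negP.
Qed.

Lemma sum_resid (V : nmodType) m (G : {poly F} -> V) :
  (forall f, ~~ coprimep f m -> G f = 0) ->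
  \sum_(r <- polys F (pdeg m)) G r = \sum_(r <- resid m) G r.
Proof.
move=> h; rewrite big_filter [RHS]big_mkcond /=; apply: eq_bigr => r _.
by case: ifPn => // /h.
Qed.

(* Both orthogonality relations say that the square character table is, up to *)
(* the factor phi m, unitary; only the order of the factors differs.          *)
Lemma dchar_orth2 m f l : m \is monic -> coprimep f m -> coprimep l m ->
  \sum_(i < phi m) dchar m i f * (dchar m i l)^*
  = (phi m)%:R * (f %% m == l %% m)%:R.
Proof.
move=> mm cf cl; have m0 := monic_neq0 mm; set n := phi m.
pose X : 'M[C]_n := \matrix_(i, r) dchar m i (nth 0 (resid m) r).
pose Y : 'M[C]_n := \matrix_(r, i) (dchar m i (nth 0 (resid m) r))^*.
have n0 : n%:R != 0 :> C by rewrite pnatr_eq0 -lt0n phi_gt0.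
have XY : X *m (n%:R^-1 *: Y) = 1%:M.
  apply/matrixP => i j; rewrite !mxE.
  transitivity (n%:R^-1 * \sum_(r <- polys F (pdeg m)) dchar m i r * (dchar m j r)^*).
    rewrite (@sum_resid C m (fun r => dchar m i r * (dchar m j r)^*)); last first.
      by move=> r cr; rewrite (char_ncop (dchar_char mm (ltn_ord i)) cr) mul0r.
    rewrite (big_nth 0) -phiE // big_mkord big_distrr /=.
    by apply: eq_bigr => r _; rewrite !mxE mulrCA.
  have ci := dchar_char mm (ltn_ord i); have cj := dchar_char mm (ltn_ord j).
  have [->|ij] := eqVneq i j.
    by rewrite (char_norm2 m0 cj) // subnn expn0 muln1 mulVf.
  have [u cu ne] : exists2 u, coprimep u m & dchar m i u != dchar m j u.
    apply: (char_neq ci cj) => e; move/eqP: ij; apply; apply: val_inj.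
    by apply: (dchar_inj mm (ltn_ord i) (ltn_ord j)) => u _; rewrite e.
  by rewrite (char_orth_mod m0 ci cj cu ne) mulr0.
have YX := mulmx1C XY.
have key r : coprimep r m -> exists2 k : 'I_n, nth 0 (resid m) k = r %% m & True.
  move=> cr; have := modp_in_resid m0 cr; rewrite -index_mem -phiE // => h.
  by exists (Ordinal h) => //=; rewrite nth_index // -index_mem -phiE.
have [k ek _] := key f cf; have [k' ek' _] := key l cl.
have := congr1 (fun M : 'M_n => M k' k) YX; rewrite !mxE.
under eq_bigr => i _ do rewrite !mxE ek ek' -mulrA
  -!(char_modE (dchar_char mm (ltn_ord i)) (esym (modp_id _ _))).
rewrite -big_distrr /= => /(congr1 ( *%R n%:R)); rewrite mulVKf // => e.
have -> : (f %% m == l %% m) = (k' == k).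
  rewrite -ek -ek' nth_uniq ?resid_uniq -?phiE ?ltn_ord // eq_sym.
  by [].
by rewrite -e; apply: eq_bigr => i _; rewrite mulrC.
Qed.

(** A character outside the list would be orthogonal to all its members. Weighting these relations
    by the values at 1 and using the second orthogonality isolates r = 1 and gives phi(m) = 0. *)
Lemma dchar_complete m chi : m \is monic -> character_mod m chi ->
  exists2 i, (i < phi m)%N & chi = dchar m i.
Proof.
move=> mm ch; apply: contrapT => h; have m0 := monic_neq0 mm.
have z (i : 'I_(phi m)) : \sum_(r <- polys F (pdeg m)) chi r * (dchar m i r)^* = 0.
  have ci := dchar_char mm (ltn_ord i).
  have [e|u cu ne] := char_neq ch ci; first by apply: h; exists (val i); first exact: ltn_ord.
  exact: char_orth_mod m0 ch ci cu ne.
have : \sum_(i < phi m) dchar m i 1 *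
    \sum_(r <- polys F (pdeg m)) chi r * (dchar m i r)^* = 0.
  by apply: big1 => i _; rewrite z mulr0.
under eq_bigr => i _ do rewrite big_distrr /=.
rewrite exchange_big /=.
have i1 : 1 %% m \in polys F (pdeg m) by rewrite mem_polys size_modp_pdeg.
rewrite (bigD1_seq (1 %% m)) ?polys_uniq //= [X in _ + X]big1_seq ?addr0.
  under eq_bigr => i _ do rewrite mulrCA.
  rewrite -big_distrr /= dchar_orth2 ?coprime1p // ?coprimep_modl ?coprime1p //.
  rewrite modp_id eqxx mulr1; have [_ <- -> _] := ch.
  by rewrite mul1r => /eqP; rewrite pnatr_eq0 -leqn0 leqNgt phi_gt0.
move=> r /andP[r1 ri]; under eq_bigr => i _ do rewrite mulrCA.
rewrite -big_distrr /=; have [cr|cr] := boolP (coprimep r m); last first.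
  by rewrite (char_ncop ch cr) mul0r.
rewrite dchar_orth2 ?coprime1p // (_ : (_ == _) = false) ?mulr0 //.
rewrite eq_sym [r %% m]modp_small ?(negPf r1) //.
by move: ri; rewrite mem_polys -ltnS pdegE.
Qed.

Lemma conductor_exists m chi : m \is monic -> character_mod m chi ->
  exists d, is_conductor m chi d.
Proof.
move=> mm ch.
pose Q n := `[< exists d, [/\ d \is monic, d %| m, induced_from m chi d & pdeg d = n] >].
have exQ : exists n, Q n.
  exists (pdeg m); apply/asboolP; exists m; split; rewrite ?dvdpp //.
  by exists chi.
case: (ex_minnP exQ) => n /asboolP[d [dm ddm ind <-]] nmin.
exists d; split => // e em edm inde; apply: nmin; apply/asboolP.
by exists e; split.
Qed.

Definition primchar d j : bool := `[< is_conductor d (dchar d j) d >].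

Lemma conductor_primchar m chi d : is_conductor m chi d ->
  exists j, [/\ (j < phi d)%N, primchar d j &
    forall f, coprimep f m -> chi f = dchar d j f].
Proof.
move=> [dm ddm [chi' [ch' e]] dmin].
have [j jd ej] := dchar_complete dm ch'; rewrite {}ej in ch' e.
exists j; split => //; apply/asboolP; split => //.
- by exists (dchar d j).
move=> e' e'm e'd [chi'' [ch'' ee]]; apply: dmin => //; first exact: dvdp_trans e'd ddm.
exists chi''; split => // f cf; rewrite e // ee //.
exact: coprimep_dvdl cf.
Qed.

(** Triviality on the units congruent to 1 mod d makes chi(u) depend only on u mod d, so a unit mod
    d can be given the value of chi at any lift coprime to m. *)
Lemma induced_from_kernel m chi d : m \is monic -> d \is monic -> d %| m ->
  character_mod m chi ->
  (forall f, coprimep f m -> f %% d = 1 %% d -> chi f = 1) -> induced_from m chi d.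
Proof.
move=> mm dm ddm ch tr; have m0 := monic_neq0 mm.
have wd u u' : coprimep u m -> coprimep u' m -> u %% d = u' %% d -> chi u = chi u'.
  move=> cu cu' e; have [v [_ cv ev]] := coprimep_inv m0 cu'.
  have e1 : chi (u * v) = 1.
    apply: tr; first by rewrite coprimepMl cu.
    rewrite mulrC -modp_mul e modp_mul mulrC -(modp_dvd (u' * v) ddm) ev.
    by rewrite modp_dvd.
  have e2 : chi (u' * v) = 1 by rewrite (char_modE ch ev); case: ch.
  have nv : chi v != 0.
    by apply/eqP => z; move: e1; rewrite (charM _ _ ch) z mulr0 => /esym/eqP; rewrite oner_eq0.
  by apply: (mulIf nv); rewrite -!(charM _ _ ch) e1 e2.
have lift f : exists u, coprimep f d -> u %% d = f %% d /\ coprimep u m.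
  have [cf|cf] := boolP (coprimep f d); last by exists 0.
  by have [u eu cu] := lift_coprime m0 ddm cf; exists u.
have [lft lftP] := choice lift.
exists (fun f => if coprimep f d then chi (lft f) else 0); split; last first.
  move=> f cf; have cfd := coprimep_dvdl ddm cf.
  by rewrite cfd; have [e c] := lftP f cfd; apply: wd.
split.
- by move=> f /negPf ->.
- move=> f; rewrite coprimep_modl; case: ifP => // cf.
  have cf' : coprimep (f %% d) d by rewrite coprimep_modl.
  have [e c] := lftP f cf; have [e' c'] := lftP _ cf'.
  by apply: wd => //; rewrite e e' modp_id.
- rewrite coprime1p; have [e c] := lftP 1 (coprime1p _).
  exact: tr.
- move=> f g cf cg; have cfg : coprimep (f * g) d by rewrite coprimepMl cf.
  rewrite cf cg cfg -(charM _ _ ch).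
  have [e1 c1] := lftP f cf; have [e2 c2] := lftP g cg; have [e3 c3] := lftP _ cfg.
  apply: wd => //; first by rewrite coprimepMl c1.
  by rewrite e3 -modp_mul -e2 modp_mul mulrC -modp_mul -e1 modp_mul mulrC.
Qed.

(** If f = 1 mod gcd(d, d'), some g satisfies g = f mod d and g = 1 mod d', so the first character
    takes at f the value of the second at g, which is 1. It is thus induced from the gcd, and
    primitivity forces d to divide d'; by symmetry d = d'. *)
Lemma primchar_inj d d' j j' : d \is monic -> d' \is monic ->
  (j < phi d)%N -> (j' < phi d')%N -> primchar d j -> primchar d' j' ->
  (forall f, coprimep f d -> coprimep f d' -> dchar d j f = dchar d' j' f) ->
  d = d' /\ j = j'.
Proof.
have half e e' i i' : e \is monic -> e' \is monic -> (i < phi e)%N -> (i' < phi e')%N ->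
  primchar e i ->
  (forall f, coprimep f e -> coprimep f e' -> dchar e i f = dchar e' i' f) ->
  e %= gcdp e e'.
  move=> em em' ie ie' /asboolP[_ _ _ emin] h; have e0 := monic_neq0 em.
  have g1 := mgcd_eqp e' e0; rewrite eqp_sym -(eqp_ltrans g1).
  have ge : mgcd e e' %| e by rewrite (eqp_dvdl _ g1) dvdp_gcdl.
  rewrite -dvdp_size_eqp // eqn_leq dvdp_leq //=.
  have gm := mgcd_monic e' e0.
  suff : (pdeg e <= pdeg (mgcd e e'))%N by rewrite -ltnS !pdegE ?monic_neq0.
  apply: emin => //; apply: induced_from_kernel => //; first exact: dchar_char.
  move=> f cf fg.
  have /chinese_gcd[g g1' g2'] : gcdp e e' %| f - 1.
    by rewrite -(eqp_dvdl _ g1) -modp_eqE fg.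
  have ci := dchar_char em ie; have ci' := dchar_char em' ie'.
  rewrite (char_modE ci (esym g1')) h.
  - by rewrite (char_modE ci' g2'); case: ci'.
  - by rewrite (coprimep_congr g1').
  - by rewrite (coprimep_congr g2') coprime1p.
move=> dm dm' jd jd' pj pj' h.
have h1 := half _ _ _ _ dm dm' jd jd' pj h.
have h2 : d' %= gcdp d' d.
  by apply: (half _ _ _ _ dm' dm jd' jd pj') => f c c'; rewrite h.
have ed : d = d'.
  apply/eqP; rewrite -eqp_monic //; apply: eqp_trans h1 _; rewrite eqp_sym.
  by apply: eqp_trans h2 _; rewrite gcdpC.
split => //; move: ed jd' h => <- jd' h.
by apply: (dchar_inj dm) => // f cf; apply: h.
Qed.

Lemma sum_mons_polys (V : nmodType) n L (G : {poly F} -> V) : (n < L)%N ->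
  \sum_(f <- polys F L) (if f \in mons F n then G f else 0) = \sum_(f <- mons F n) G f.
Proof.
move=> nL; rewrite -big_mkcond /= -[LHS]big_filter; apply: perm_big; apply: uniq_perm.
- by rewrite filter_uniq ?polys_uniq.
- exact: mons_uniq.
move=> f; rewrite mem_filter mem_polys; case: (boolP (f \in mons F n)) => //= h.
by case/mem_monsP: h => _ ->.
Qed.

(* Distinct primitive characters of moduli of degree r are orthogonal on the  *)
(* set of all polynomials of degree < L as soon as 2r <= L, so the large sieve *)
(* inequality is Bessel's inequality.                                         *)
Lemma large_sieve r L n (a : {poly F} -> C) : (r + r <= L)%N -> (n < L)%N ->
  \sum_(d <- mons F r) \sum_(j < phi d | primchar d j)
     normc (\sum_(f <- mons F n) a f * dchar d j f) ^+ 2 / (phi d)%:R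
  <= #|F|%:R ^+ (L - r) * \sum_(f <- mons F n) normc (a f) ^+ 2.
Proof.
move=> rL nL; pose J := [seq (d, j) | d <- mons F r, j <- filter (primchar d) (iota 0 (phi d))].
have JP d j : (d, j) \in J -> [/\ d \is monic, pdeg d = r, (j < phi d)%N & primchar d j].
  move=> /allpairsPdep[d' [j' [hd hj [-> ->]]]].
  move: hd; rewrite mem_mons => /andP[dm /eqP pd].
  by move: hj; rewrite mem_filter mem_iota add0n => /andP[? ?]; split.
have uJ : uniq J.
  apply: allpairs_uniq_dep; first exact: mons_uniq.
    by move=> d _; rewrite filter_uniq ?iota_uniq.
  by move=> [x y] [x' y'] _ _ /= [-> ->].
have q0 : (0 < #|F|)%N := ltnW (finNzRing_gt1 F).
pose w (p : {poly F} * nat) : C := (phi p.1 * #|F| ^ (L - r))%:R.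
pose v (p : {poly F} * nat) f := dchar p.1 p.2 f.
pose a' f := if f \in mons F n then a f else 0.
have w0 p : p \in J -> 0 < w p.
  case: p => d j /JP[dm _ _ _]; rewrite ltr0n muln_gt0 phi_gt0 ?monic_neq0 //.
  by rewrite expn_gt0 q0.
have orth p p' : p \in J -> p' \in J ->
   \sum_(f <- polys F L) v p f * (v p' f)^* = if p == p' then w p else 0.
  case: p => d j; case: p' => d' j' hJ hJ'.
  have [dm pd jd pj] := JP _ _ hJ; have [dm' pd' jd' pj'] := JP _ _ hJ'.
  have ch := dchar_char dm jd; have ch' := dchar_char dm' jd'.
  case: eqP => [[ed ej]|ne].
    rewrite /v /w /= -ed -ej (char_norm2 (monic_neq0 dm) ch) pd //.
    exact: leq_trans (leq_addr _ _) rL.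
  have [u [cu cu' neu]] : exists u, [/\ coprimep u d, coprimep u d' &
       dchar d j u != dchar d' j' u].
    apply: contrapT => h; apply: ne.
    suff [-> ->] : d = d' /\ j = j' by [].
    apply: primchar_inj => // f c c'; apply/eqP/negP => n'.
    by apply: h; exists f; split => //; apply/negP.
  by apply: (@char_orth _ _ L d d' _ _ u) => //; rewrite ?monic_neq0 ?pd ?pd'.
have := @bessel C _ (polys F L) _ J v w a' uJ w0 orth.
have -> : \sum_(x <- polys F L) `|a' x| ^+ 2 = (\sum_(f <- mons F n) normc (a f) ^+ 2)%:C.
  rewrite rmorph_sum -(sum_mons_polys _ nL); apply: eq_bigr => f _.
  by rewrite /a'; case: ifP; rewrite ?normr0 ?expr0n // normcE rmorphXn.
have -> : \sum_(i <- J) `|\sum_(x <- polys F L) a' x * v i x| ^+ 2 / w i =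
   (\sum_(d <- mons F r) \sum_(j < phi d | primchar d j)
     normc (\sum_(f <- mons F n) a f * dchar d j f) ^+ 2
        / ((phi d)%:R * #|F|%:R ^+ (L - r)))%:C.
  rewrite /J big_allpairs_dep rmorph_sum; apply: eq_bigr => d _.
  rewrite big_filter rmorph_sum /= -[iota _ _]/(iota 0 _) -{1}(subn0 (phi d)) big_mkord.
  apply: eq_bigr => j _; rewrite fmorph_div rmorphXn /= /w natrM natrX rmorphM rmorphXn !rmorph_nat.
  congr (_ ^+ 2 / _); rewrite -normcE; congr `|_|.
  rewrite -(sum_mons_polys _ nL); apply: eq_bigr => f _; rewrite /a' /v /=.
  by case: ifP; rewrite ?mul0r.
rewrite lecR => h; rewrite mulrC -ler_pdivrMr ?exprn_gt0 ?ltr0n //.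
apply: le_trans h; rewrite le_eqVlt; apply/orP; left; apply/eqP.
rewrite big_distrl; apply: eq_bigr => d _; rewrite big_distrl; apply: eq_bigr => j _.
by rewrite invfM mulrA.
Qed.
End DualGroup.

(** * Growth and the Siegel-Walfisz bound *)

Lemma eq_ler (R : numDomainType) (x y : R) : x = y -> x <= y.
Proof. by move=> ->. Qed.

Section Growth.
Variables (R : realType) (F : finFieldType).
Implicit Types (f g m d : {poly F}) (psi chi : {poly F} -> R[i]).
Local Notation normc := Normc.normc.
Local Notation q := (#|F|%:R : R).

Lemma growth_nat psi : growth_condition psi <->
  exists k : nat, exists2 K : R, 0 <= K &
    forall f, f \is monic -> normc (psi f) <= K * (tau f)%:R ^+ k.
Proof.
have t1 f : f \is monic -> (1 : R) <= (tau f)%:R by move=> fm; rewrite ler1n tau_gt0.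
split=> [[C C0 [K hK]]|[k [K K0 hK]]]; last first.
  (* The growth condition asks for a positive exponent, hence k + 1. *)
  exists k.+1%:R; rewrite ?ltr0n //; exists K => f fm; apply: le_trans (hK f fm) _.
  by rewrite powR_mulrn // ler_wpM2l // exprS ler_peMl ?exprn_ge0 ?t1.
exists (Num.bound C); exists `|K| => // f fm; apply: le_trans (hK f fm) _.
apply: (@le_trans _ _ (`|K| * (tau f)%:R `^ C)).
  by rewrite ler_wpM2r ?powR_ge0 ?ler_norm.
rewrite ler_wpM2l // -powR_mulrn //; apply: ler_powR; rewrite ?t1 //.
by apply/ltW/archi_boundP/ltW.
Qed.

(** Both |psi| and |psi|^2 are at most (K + K^2) tau^(2k), so a single moment of tau bounds both
    sums. *)
Lemma growth_moments psi : growth_condition psi ->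
  exists c : nat, exists2 K : R, 0 <= K & forall n,
    \sum_(f <- mons F n) normc (psi f) <= K * (q ^+ n * n.+1%:R ^+ c) /\
    \sum_(f <- mons F n) normc (psi f) ^+ 2 <= K * (q ^+ n * n.+1%:R ^+ c).
Proof.
move=> /growth_nat[k [K K0 hK]]; exists (2 ^ (k * 2)).-1; exists (K + K ^+ 2).
  by rewrite addr_ge0 ?exprn_ge0.
move=> n; have mom := tau_moment F R (k * 2) n.
have pt f : f \in mons F n -> normc (psi f) <= (K + K ^+ 2) * (tau f)%:R ^+ (k * 2) /\
    normc (psi f) ^+ 2 <= (K + K ^+ 2) * (tau f)%:R ^+ (k * 2).
  move=> /mem_monsP[fm _]; have t1 : (1 : R) <= (tau f)%:R by rewrite ler1n tau_gt0.
  have tk : 1 <= (tau f)%:R ^+ k :> R by rewrite exprn_ege1.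
  have h := hK f fm; set t := (tau f)%:R ^+ k in h tk *; rewrite exprM -/t.
  split.
    apply: le_trans h _; rewrite ler_pM ?(le_trans _ tk) ?lerDl ?exprn_ge0 //.
    by rewrite expr2 ler_peMl ?(le_trans _ tk).
  apply: (@le_trans _ _ ((K * t) ^+ 2)).
    by rewrite lerXn2r ?nnegrE ?normc_ge0 ?mulr_ge0 ?(le_trans _ tk).
  by rewrite exprMn ler_wpM2r ?exprn_ge0 ?(le_trans _ tk) // lerDr.
split.
  apply: (@le_trans _ _ (\sum_(f <- mons F n) (K + K ^+ 2) * (tau f)%:R ^+ (k * 2))).
    by rewrite big_seq [leRHS]big_seq; apply: ler_sum => f /pt[].
  by rewrite -big_distrr /= ler_wpM2l ?addr_ge0 ?exprn_ge0.
apply: (@le_trans _ _ (\sum_(f <- mons F n) (K + K ^+ 2) * (tau f)%:R ^+ (k * 2))).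
  by rewrite big_seq [leRHS]big_seq; apply: ler_sum => f /pt[].
by rewrite -big_distrr /= ler_wpM2l ?addr_ge0 ?exprn_ge0.
Qed.

Lemma dirichlet_convE psi1 psi2 f : f \is monic ->
  dirichlet_conv psi1 psi2 f = \sum_(g <- divs f) psi1 g * psi2 (f %/ g).
Proof.
move=> fm; rewrite /dirichlet_conv -(sum_factor (fun g h => psi1 g * psi2 h)) //.
rewrite -(big_npoly _ _ (fun g => g \is monic)); apply: eq_bigr => g _.
by rewrite (big_npoly _ _ (fun h => (h \is monic) && (val g * h == f))
  (fun h => psi1 (val g) * psi2 h)).
Qed.

Lemma growth_conv psi1 psi2 : growth_condition psi1 -> growth_condition psi2 ->
  growth_condition (dirichlet_conv psi1 psi2).
Proof.
move=> /growth_nat[k1 [K1 K10 h1]] /growth_nat[k2 [K2 K20 h2]]; apply/growth_nat.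
exists (k1 + k2).+1; exists (K1 * K2); first exact: mulr_ge0.
move=> f fm; have f0 := monic_neq0 fm; rewrite dirichlet_convE //.
apply: le_trans (normc_sum _ _ _) _.
apply: (@le_trans _ _ (\sum_(g <- divs f) K1 * K2 * (tau f)%:R ^+ (k1 + k2))).
  rewrite big_seq [leRHS]big_seq; apply: ler_sum => g; rewrite mem_divs // => /andP[gm gf].
  have e : g * (f %/ g) = f by rewrite mulrC divpK.
  have hm : f %/ g \is monic by move: fm; rewrite -{1}e monicMl.
  rewrite Normc.normcM exprD mulrACA ler_pM ?normc_ge0 //.
    apply: le_trans (h1 g gm) _; rewrite ler_wpM2l // lerXn2r ?nnegrE // ler_nat.
    exact: tau_dvd.
  apply: le_trans (h2 _ hm) _; rewrite ler_wpM2l // lerXn2r ?nnegrE // ler_nat.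
  by apply: tau_dvd => //; rewrite -{2}e dvdp_mull.
by rewrite sum_const_seq -tauE -[leLHS]mulr_natr -mulrA -exprSr.
Qed.

Lemma sum_conv psi1 psi2 n (w : {poly F} -> R[i]) :
  \sum_(f <- mons F n) dirichlet_conv psi1 psi2 f * w f
  = \sum_(a < n.+1) \sum_(g <- mons F a) \sum_(h <- mons F (n - a))
      psi1 g * psi2 h * w (g * h).
Proof.
rewrite -(sum_mons_divs n (fun g h => psi1 g * psi2 h * w (g * h))).
apply: eq_big_seq => f /mem_monsP[fm _]; rewrite dirichlet_convE // big_distrl /=.
apply: eq_big_seq => g; rewrite mem_divs ?monic_neq0 // => /andP[_ gf].
by rewrite [g * (f %/ g)]mulrC divpK.
Qed.

Definition csum psi n chi : R[i] := \sum_(f <- mons F n) psi f * chi f.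

Lemma csum_conv psi1 psi2 n m chi : character_mod m chi ->
  csum (dirichlet_conv psi1 psi2) n chi
  = \sum_(a < n.+1) csum psi1 a chi * csum psi2 (n - a) chi.
Proof.
move=> ch; rewrite /csum sum_conv; apply: eq_bigr => a _; rewrite big_distrl /=.
apply: eq_bigr => g _; rewrite big_distrr /=; apply: eq_bigr => h _.
by rewrite (charM _ _ ch) mulrACA.
Qed.

Lemma normc_csum psi n m chi : m != 0 -> character_mod m chi ->
  normc (csum psi n chi) <= \sum_(f <- mons F n) normc (psi f).
Proof.
move=> m0 ch; apply: le_trans (normc_sum _ _ _) _; apply: ler_sum => f _.
by rewrite Normc.normcM ler_piMr ?normc_ge0 // (char_norm_le1 _ m0 ch).
Qed.

Lemma siegel_walfisz_csum psi : siegel_walfisz psi ->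
  exists2 D0 : R, 0 < D0 & forall D, D0 <= D -> exists2 K : R, 0 <= K &
    forall n m d chi, (0 < n)%N -> (0 < pdeg m)%N ->
      character_mod m chi -> ~ principal_mod m chi -> is_conductor m chi d ->
      (pdeg d)%:R <= D * logq F n%:R ->
      normc (csum psi n chi) <= K * (q ^+ n / n%:R `^ (3 * D)).
Proof.
move=> [D0 D00 h]; exists D0 => // D /h[K hK]; exists `|K| => // n m d chi n0 m0 ch np cd hd.
have := hK n m d chi n0 m0 ch np cd hd; rewrite (sum_monic_deg1 _ (fun f => psi f * chi f)).
move/le_trans; apply; rewrite ler_wpM2r ?ler_norm //.
by rewrite divr_ge0 ?exprn_ge0 ?powR_ge0.
Qed.

Lemma ln_card_gt0 : 0 < ln q.
Proof. by rewrite ln_gt0 // ltr1n finNzRing_gt1. Qed.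

Lemma logq_le (x y : R) : 0 < x -> x <= y -> logq F x <= logq F y.
Proof.
move=> x0 xy; rewrite /logq ler_wpM2r ?invr_ge0 ?(ltW ln_card_gt0) //.
by rewrite ler_ln ?posrE // (lt_le_trans x0).
Qed.

Lemma logq_sqr (x : R) : 0 < x -> logq F (x ^+ 2) = 2 * logq F x.
Proof. by move=> x0; rewrite /logq lnXn // mulr_natl mulrnAl. Qed.

Lemma powR_ge_exp (x D : R) k : 1 <= x -> k%:R <= D -> x ^+ k <= x `^ D.
Proof.
by move=> x1 kD; rewrite -powR_mulrn ?(le_trans _ x1) //; exact: ler_powR.
Qed.

(** Transfers Siegel-Walfisz from degree n to the scale N. From N <= j n <= n^2 one gets log N <= 2
    log n, so level 2D at n covers the conductors allowed at level D for N; the saving n^(6D) is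
    N^(6D) up to j^(6D). *)
Lemma siegel_walfisz_level (D : R) j n N : 0 <= D -> (N <= j * n)%N -> (j <= n)%N ->
  (1 < j)%N -> (0 < N)%N ->
  (D * logq F N%:R <= 2 * D * logq F n%:R) /\
  (n%:R `^ (3 * (2 * D)))^-1 <= (j%:R `^ (6 * D)) / (N%:R `^ (6 * D) : R).
Proof.
move=> D0 Njn jn j1 N0; have n0 : (0 < n)%N by lia.
split.
  rewrite (mulrC 2) -mulrA ler_wpM2l // -logq_sqr ?ltr0n //; apply: logq_le; rewrite ?ltr0n //.
  by rewrite -natrX ler_nat (leq_trans Njn) // -mulnn leq_mul2r jn orbT.
have -> : 3 * (2 * D) = 6 * D by ring.
rewrite ler_pdivlMr ?powR_gt0 ?ltr0n // mulrC ler_pdivrMr ?powR_gt0 ?ltr0n //.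
rewrite -powRM ?ler0n //; apply: ge0_ler_powR; rewrite ?nnegrE ?mulr_ge0 //.
by rewrite -natrM ler_nat.
Qed.
Lemma siegel_walfisz_conv psi1 psi2 :
  growth_condition psi1 -> growth_condition psi2 ->
  siegel_walfisz psi1 -> siegel_walfisz psi2 ->
  siegel_walfisz (dirichlet_conv psi1 psi2).
Proof.
move=> /growth_moments[c1 [M1 M10 g1]] /growth_moments[c2 [M2 M20 g2]].
move=> /siegel_walfisz_csum[D1 D10 s1] /siegel_walfisz_csum[D2 D20 s2].
pose c := (c1 + c2)%N.
(* The summand c + 1 ensures 3D >= c + 1: the trivial bounds lose N^c and the number of splittings
   loses one more power. *)
exists (D1 + D2 + c.+1%:R); first by rewrite !addr_gt0 ?ltr0n.
move=> D hD; have D0 : 0 <= D by apply: le_trans hD; rewrite !addr_ge0 ?ltW.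
have cp : (1 : R) <= c.+1%:R by rewrite ler1n.
have D1D : D1 <= 2 * D by move: hD; lra.
have D2D : D2 <= 2 * D by move: hD; lra.
have [K1 K10 h1] := s1 _ D1D; have [K2 K20 h2] := s2 _ D2D.
have cD : c.+1%:R <= 3 * D by move: hD; lra.
pose T := (K1 * M2 + K2 * M1) * 2 `^ (6 * D) * 2 ^+ c.+1.
pose T' := M1 * M2 * 4 ^+ c.+1 * 4 `^ (3 * D).
exists (T + T') => N m d chi N0 m0 ch np cd hd.
have mz : m != 0 by move: m0; rewrite /pdeg; case: eqP => // ->; rewrite size_poly0.
rewrite (sum_monic_deg1 _ (fun f => dirichlet_conv psi1 psi2 f * chi f)).
rewrite -/(csum _ _ _) (csum_conv _ _ _ ch).
have N1 : 1 <= N%:R :> R by rewrite ler1n.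
have NS : 1 <= N.+1%:R :> R by rewrite ler1n.
have q1 : 1 <= q by rewrite ler1n ltnW // finNzRing_gt1.
have T0 : 0 <= T by rewrite !mulr_ge0 ?addr_ge0 ?mulr_ge0 ?powR_ge0 ?exprn_ge0.
have T'0 : 0 <= T' by rewrite !mulr_ge0 ?powR_ge0 ?exprn_ge0.
have S0 : 0 <= q ^+ N / N%:R `^ (3 * D) by rewrite divr_ge0 ?exprn_ge0 ?powR_ge0.
have triv1 n : (n <= N)%N -> normc (csum psi1 n chi) <= M1 * (q ^+ n * N.+1%:R ^+ c1).
  move=> nN; apply: le_trans (normc_csum _ _ mz ch) _; apply: le_trans (proj1 (g1 n)) _.
  by rewrite !ler_wpM2l ?exprn_ge0 // lerXn2r ?nnegrE ?ler_nat.
have triv2 n : (n <= N)%N -> normc (csum psi2 n chi) <= M2 * (q ^+ n * N.+1%:R ^+ c2).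
  move=> nN; apply: le_trans (normc_csum _ _ mz ch) _; apply: le_trans (proj1 (g2 n)) _.
  by rewrite !ler_wpM2l ?exprn_ge0 // lerXn2r ?nnegrE ?ler_nat.
apply: le_trans (normc_sum _ _ _) _.
(* From N = 4 on, the longer factor has degree at least 2, as [siegel_walfisz_level] with j = 2
   requires; smaller N only affect the constant. *)
have [N4|N4] := ltnP N 4.
  apply: (@le_trans _ _ (T' * (q ^+ N / N%:R `^ (3 * D)))); last first.
    by rewrite ler_wpM2r // lerDr.
  apply: (@le_trans _ _ (\sum_(a < N.+1) M1 * M2 * (q ^+ N * N.+1%:R ^+ c))).
    apply: ler_sum => a _; have aN : (a <= N)%N by rewrite -ltnS.
    rewrite Normc.normcM; apply: le_trans (ler_pM _ _ (triv1 a aN) (triv2 _ (leq_subr a N))) _;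
      rewrite ?normc_ge0 //.
    by rewrite mulrACA ler_wpM2l ?mulr_ge0 // mulrACA -!exprD subnKC.
  rewrite sumr_const card_ord -[leLHS]mulr_natr -!mulrA -exprSr.
  have e1 : N.+1%:R ^+ c.+1 <= 4 ^+ c.+1 :> R by rewrite lerXn2r ?nnegrE // ler_nat.
  have e2 : 1 <= 4 `^ (3 * D) / N%:R `^ (3 * D) :> R.
    rewrite ler_pdivlMr ?powR_gt0 ?ltr0n // mul1r.
    by apply: ge0_ler_powR; rewrite ?nnegrE ?mulr_ge0 // ler_nat ltnW.
  apply: (@le_trans _ _ (M1 * M2 * q ^+ N * (N.+1%:R ^+ c.+1 * 1))).
    by rewrite mulr1 !mulrA.
  apply: (@le_trans _ _ (M1 * M2 * q ^+ N * (4 ^+ c.+1 * (4 `^ (3 * D) / N%:R `^ (3 * D))))).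
    by rewrite ler_wpM2l ?mulr_ge0 ?exprn_ge0 // ler_pM ?exprn_ge0.
  by apply: eq_ler; rewrite /T'; ring.
apply: (@le_trans _ _ (T * (q ^+ N / N%:R `^ (3 * D)))); last first.
  by rewrite ler_wpM2r // lerDl.
have [V VE] : exists V : R, V = (2 `^ (6 * D)) / (N%:R `^ (6 * D) : R) by eexists.
have lev n : (n <= N)%N -> (N <= 2 * n)%N ->
   normc (csum psi1 n chi) <= K1 * (q ^+ n * V) /\ normc (csum psi2 n chi) <= K2 * (q ^+ n * V).
  move=> nN Nn; have n0 : (0 < n)%N by clear -Nn N4; lia.
  have [|l1 l2] := siegel_walfisz_level D0 Nn _ isT N0; first by clear -Nn N4; lia.
  split.
    apply: le_trans (h1 n m d chi n0 m0 ch np cd (le_trans hd l1)) _.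
    by rewrite VE !ler_wpM2l ?exprn_ge0.
  apply: le_trans (h2 n m d chi n0 m0 ch np cd (le_trans hd l1)) _.
  by rewrite VE !ler_wpM2l ?exprn_ge0.
have V0 : 0 <= V by rewrite VE divr_ge0 ?powR_ge0.
apply: (@le_trans _ _ (\sum_(a < N.+1) (K1 * M2 + K2 * M1) * (q ^+ N * (V * N.+1%:R ^+ c)))).
  apply: ler_sum => a _; have aN : (a <= N)%N by rewrite -ltnS.
  have bN := leq_subr a N; rewrite Normc.normcM.
  have [h|h] := leqP N (2 * a).
    have [l _] := lev a aN h.
    apply: le_trans (ler_pM _ _ l (triv2 _ bN)) _; rewrite ?normc_ge0 //.
    rewrite mulrACA ler_pM ?mulr_ge0 ?exprn_ge0 //.
      by rewrite lerDl mulr_ge0.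
    rewrite mulrACA -exprD subnKC // !ler_wpM2l ?exprn_ge0 //.
    by apply: ler_weXn2l => //; rewrite leq_addl.
  have [|_ l] := lev (N - a)%N bN; first by clear -h; lia.
  apply: le_trans (ler_pM _ _ (triv1 _ aN) l) _; rewrite ?normc_ge0 //.
  rewrite mulrACA ler_pM ?mulr_ge0 ?exprn_ge0 //.
    by rewrite mulrC lerDr mulr_ge0.
  rewrite mulrACA -exprD subnKC // ler_wpM2l ?exprn_ge0 // mulrC ler_wpM2l //.
  by apply: ler_weXn2l => //; rewrite leq_addr.
rewrite sumr_const card_ord -[leLHS]mulr_natr.
(* The saving V is a constant over x^2 and the losses are at most a constant times x, so one factor
   1/x survives. *)
set x := N%:R `^ (3 * D); have x0 : 0 < x by rewrite powR_gt0 ?ltr0n.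
have Vx : V = 2 `^ (6 * D) / (x * x).
  rewrite VE /x -powRD ?(gt_eqF (lt_le_trans ltr01 N1)) ?implybT //.
  by congr (_ / _ `^ _); ring.
have e3 : N.+1%:R ^+ c.+1 <= 2 ^+ c.+1 * x.
  apply: (@le_trans _ _ ((2 * N%:R) ^+ c.+1)).
    by rewrite lerXn2r ?nnegrE ?mulr_ge0 // -natrM ler_nat; clear -N0; lia.
  by rewrite exprMn ler_wpM2l ?exprn_ge0 //; exact: powR_ge_exp.
apply: (@le_trans _ _ ((K1 * M2 + K2 * M1) * q ^+ N * (2 `^ (6 * D) / (x * x)) * (2 ^+ c.+1 * x))).
  apply: (@le_trans _ _ ((K1 * M2 + K2 * M1) * q ^+ N * V * N.+1%:R ^+ c.+1)).
    by apply: eq_ler; rewrite exprS; ring.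
  by rewrite -Vx ler_wpM2l ?mulr_ge0 ?addr_ge0 ?mulr_ge0 ?exprn_ge0.
by apply: eq_ler; rewrite /T; field; rewrite gt_eqF.
Qed.
End Growth.

(** * Bilinear errors *)

Section BilinearError.
Variables (R : realType) (F : finFieldType).
Implicit Types (f g h l m d : {poly F}) (psi chi : {poly F} -> R[i]).
Local Notation normc := Normc.normc.
Local Notation C := (R[i]).
Local Notation "x ^*" := (Num.conj x).

Lemma progression_errorE psi M m l : progression_error psi M m l =
  \sum_(f <- mons F M | f %% m == l %% m) psi f
  - (phi m)%:R^-1 * \sum_(f <- mons F M | coprimep f m) psi f.
Proof.
rewrite /progression_error (sum_monic_deg M (fun f => f %% m == l %% m) psi).
by rewrite (sum_monic_deg M (fun f => coprimep f m) psi).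
Qed.

Definition bilinear_error psi1 psi2 a b m l : C :=
  \sum_(g <- mons F a) \sum_(h <- mons F b | (g * h) %% m == l %% m) psi1 g * psi2 h
  - (phi m)%:R^-1 *
    \sum_(g <- mons F a) \sum_(h <- mons F b | coprimep (g * h) m) psi1 g * psi2 h.

Lemma bilinear_errorC psi1 psi2 a b m l :
  bilinear_error psi1 psi2 a b m l = bilinear_error psi2 psi1 b a m l.
Proof.
have swap (P : pred {poly F}) :
    \sum_(g <- mons F a) \sum_(h <- mons F b | P (g * h)) psi1 g * psi2 h
    = \sum_(h <- mons F b) \sum_(g <- mons F a | P (h * g)) psi2 h * psi1 g.
  under eq_bigr => g _ do rewrite big_mkcond.
  rewrite exchange_big /=; apply: eq_bigr => h _; rewrite [RHS]big_mkcond.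
  by apply: eq_bigr => g _; rewrite [h * g]mulrC [psi2 h * _]mulrC.
rewrite /bilinear_error (swap (fun f => f %% m == l %% m)).
by rewrite (swap (fun f => coprimep f m)).
Qed.

Lemma progression_error_conv psi1 psi2 M m l :
  progression_error (dirichlet_conv psi1 psi2) M m l
  = \sum_(a < M.+1) bilinear_error psi1 psi2 a (M - a) m l.
Proof.
rewrite progression_errorE /bilinear_error sumrB -big_distrr /=.
have red (P : pred {poly F}) : \sum_(f <- mons F M | P f) dirichlet_conv psi1 psi2 f =
   \sum_(a < M.+1) \sum_(g <- mons F a) \sum_(h <- mons F (M - a) | P (g * h))
     psi1 g * psi2 h.
  rewrite big_mkcond (eq_bigr (fun f => dirichlet_conv psi1 psi2 f * (P f)%:R)).
    rewrite (sum_conv psi1 psi2 M (fun f => (P f)%:R)).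
    apply: eq_bigr => a _; apply: eq_bigr => g _; rewrite [RHS]big_mkcond.
    by apply: eq_bigr => h _; case: (P _); rewrite ?mulr1 ?mulr0.
  by move=> f _; case: (P f); rewrite ?mulr1 ?mulr0.
by rewrite (red (fun f => f %% m == l %% m)) (red (fun f => coprimep f m)).
Qed.

Definition princ m i : bool := `[< principal_mod m (dchar R m i) >].

(** Orthogonality detects the congruence g h = l mod m; the unique principal character contributes
    exactly the subtracted mean value. *)
Lemma bilinear_error_dchar psi1 psi2 a b m l : m \is monic -> coprimep l m ->
  bilinear_error psi1 psi2 a b m l = (phi m)%:R^-1 *
    \sum_(i < phi m | ~~ princ m i)
       (dchar R m i l)^* * (csum psi1 a (dchar R m i) * csum psi2 b (dchar R m i)).
Proof.
move=> mm cl; have m0 := monic_neq0 mm.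
have n0 : (phi m)%:R != 0 :> C by rewrite pnatr_eq0 -lt0n phi_gt0.
have prod i : (i < phi m)%N -> csum psi1 a (dchar R m i) * csum psi2 b (dchar R m i) =
   \sum_(g <- mons F a) \sum_(h <- mons F b) psi1 g * psi2 h * dchar R m i (g * h).
  move=> im; rewrite /csum big_distrl /=; apply: eq_bigr => g _.
  rewrite big_distrr /=; apply: eq_bigr => h _.
  by rewrite (charM _ _ (dchar_char R mm im)) mulrACA.
have full : \sum_(i < phi m)
    (dchar R m i l)^* * (csum psi1 a (dchar R m i) * csum psi2 b (dchar R m i))
  = (phi m)%:R * \sum_(g <- mons F a) \sum_(h <- mons F b | (g * h) %% m == l %% m)
       psi1 g * psi2 h.
  under eq_bigr => i _ do rewrite prod ?ltn_ord // big_distrr /=.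
  rewrite exchange_big /= big_distrr /=; apply: eq_bigr => g _.
  under eq_bigr => i _ do rewrite big_distrr /=.
  rewrite exchange_big /= [in RHS]big_mkcond big_distrr /=; apply: eq_bigr => h _.
  under eq_bigr => i _ do rewrite mulrCA [X in _ * X]mulrC.
  rewrite -big_distrr /=; have [c|c] := boolP (coprimep (g * h) m).
    by rewrite dchar_orth2 //; case: (_ == _); rewrite ?mulr1 ?mulr0 // mulrC.
  rewrite ifF; last first.
    by apply/negP => /eqP e; move: c; rewrite (coprimep_congr e) cl.
  rewrite big1 ?mulr0 // => i _.
  by rewrite (char_ncop (dchar_char R mm (ltn_ord i)) c) mul0r.
have [i0 i0m pr] : exists2 i0 : 'I_(phi m), princ m i0 &
     forall i : 'I_(phi m), princ m i -> i = i0.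
  have ch0 : character_mod m (fun f => (coprimep f m)%:R : C).
    split; rewrite ?coprime1p //.
    - by move=> f /negPf ->.
    - by move=> f; rewrite coprimep_modl.
    - by move=> f g cf cg; rewrite coprimepMl cf cg mulr1.
  have [i im ei] := dchar_complete mm ch0.
  have pi : princ m i by apply/asboolP => f cf; rewrite -ei cf.
  exists (Ordinal im) => // j /asboolP pj; apply: val_inj => /=.
  apply: (@dchar_inj R F m _ _ mm (ltn_ord j) im) => f cf.
  by move/asboolP: pi => pi; rewrite pj ?pi.
have pterm : (dchar R m i0 l)^* * (csum psi1 a (dchar R m i0) * csum psi2 b (dchar R m i0))
  = \sum_(g <- mons F a) \sum_(h <- mons F b | coprimep (g * h) m) psi1 g * psi2 h.
  move/asboolP: i0m => i0m; rewrite i0m // conjC1 mul1r prod ?ltn_ord //.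
  apply: eq_bigr => g _; rewrite [RHS]big_mkcond; apply: eq_bigr => h _.
  case: ifPn => [/i0m ->|c]; first by rewrite mulr1.
  by rewrite (char_ncop (dchar_char R mm (ltn_ord i0)) c) mulr0.
rewrite /bilinear_error -pterm -[X in X - _](mulKf n0) -full -mulrBr; congr (_ * _).
rewrite (bigID (fun i : 'I_(phi m) => princ m i)) /= (big_pred1 i0).
  by rewrite addrAC subrr add0r.
by move=> i; apply/idP/eqP => [/pr|->].
Qed.

(** The character expansion in absolute values no longer depends on l, so the maximum over residue
    classes is free. *)
Definition charbound psi1 psi2 a b m : R := (phi m)%:R^-1 *
    \sum_(i < phi m | ~~ princ m i)
       normc (csum psi1 a (dchar R m i)) * normc (csum psi2 b (dchar R m i)).

Lemma normc_natV n : normc ((n%:R)^-1 : C) = n%:R^-1.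
Proof. by rewrite Normc.normcV normc_nat. Qed.

Lemma bilinear_error_le psi1 psi2 a b m l : m \is monic -> coprimep l m ->
  normc (bilinear_error psi1 psi2 a b m l) <= charbound psi1 psi2 a b m.
Proof.
move=> mm cl; have m0 := monic_neq0 mm; rewrite bilinear_error_dchar //.
rewrite Normc.normcM normc_natV ler_wpM2l ?invr_ge0 //.
apply: le_trans (normc_sum _ _ _) _; apply: ler_sum => i _.
rewrite !Normc.normcM normc_conj ler_piMl ?mulr_ge0 ?normc_ge0 //.
exact: (char_norm_le1 _ m0 (dchar_char R mm (ltn_ord i))).
Qed.

Lemma bilinear_error_triv psi1 psi2 a b m l : m \is monic ->
  normc (bilinear_error psi1 psi2 a b m l) <=
  2 * ((\sum_(g <- mons F a) normc (psi1 g)) * (\sum_(h <- mons F b) normc (psi2 h))).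
Proof.
move=> mm; have m0 := monic_neq0 mm.
set S := (\sum_(g <- mons F a) _) * _.
have part (P : {poly F} -> {poly F} -> bool) :
   normc (\sum_(g <- mons F a) \sum_(h <- mons F b | P g h) psi1 g * psi2 h) <= S.
  apply: le_trans (normc_sum _ _ _) _; rewrite /S big_distrl /=; apply: ler_sum => g _.
  apply: le_trans (normc_sum _ _ _) _; rewrite big_distrr /= big_mkcond.
  apply: ler_sum => h _; rewrite -Normc.normcM; case: ifP => // _; exact: normc_ge0.
rewrite /bilinear_error; apply: le_trans (le_normcD _ _) _.
rewrite normcN Normc.normcM normc_natV mulrDl mul1r lerD ?part //.
apply: le_trans (part (fun g h => coprimep (g * h) m)).
by rewrite ler_piMl ?normc_ge0 // invf_le1 ?ltr0n ?ler1n ?phi_gt0.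
Qed.

(** For h coprime to m, g h = l mod m means that g lies in the class of l times the inverse of h.
    The class varies with h, which the maximum over classes in the equidistribution hypothesis
    allows. *)
Lemma bilinear_error_prog psi1 psi2 a b m l : m \is monic -> coprimep l m ->
  exists l' : {poly F} -> {poly F},
  (forall h, coprimep h m -> coprimep (l' h) m /\ (size (l' h) <= pdeg m)%N) /\
  bilinear_error psi1 psi2 a b m l =
    \sum_(h <- mons F b | coprimep h m) psi2 h * progression_error psi1 a m (l' h).
Proof.
move=> mm cl; have m0 := monic_neq0 mm.
have hinv h : exists g, coprimep h m -> coprimep g m /\ (h * g) %% m = 1 %% m.
  have [ch|ch] := boolP (coprimep h m); last by exists 0.
  by have [g [_ cg eg]] := coprimep_inv m0 ch; exists g.
have [inv invP] := choice hinv.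
exists (fun h => (l * inv h) %% m); split.
  move=> h /invP[ci _]; rewrite size_modp_pdeg //; split => //.
  by rewrite coprimep_modl coprimepMl cl.
rewrite bilinear_errorC /bilinear_error.
have -> : \sum_(h <- mons F b) \sum_(g <- mons F a | (h * g) %% m == l %% m) psi2 h * psi1 g
  = \sum_(h <- mons F b | coprimep h m) psi2 h *
     \sum_(g <- mons F a | g %% m == (l * inv h) %% m) psi1 g.
  rewrite [RHS]big_mkcond; apply: eq_bigr => h _; case: ifPn => [ch|ch]; last first.
    rewrite big1 // => g /eqP e; move: ch.
    have : coprimep (h * g) m by rewrite (coprimep_congr e).
    by rewrite coprimepMl => /andP[->].
  rewrite big_distrr /=; apply: eq_bigl => g; have [ci ei] := invP h ch.
  apply/eqP/eqP => e.
    rewrite mulrC -modp_mul -e modp_mul mulrCA mulrA -modp_mul.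
    rewrite -[g in LHS]mulr1 -[in LHS]modp_mul -ei modp_mul.
    by rewrite modp_mul; congr (_ %% _); ring.
  rewrite -modp_mul e modp_mul mulrCA -modp_mul ei modp_mul mulr1 //.
have -> : \sum_(h <- mons F b) \sum_(g <- mons F a | coprimep (h * g) m) psi2 h * psi1 g
  = \sum_(h <- mons F b | coprimep h m) psi2 h *
     \sum_(g <- mons F a | coprimep g m) psi1 g.
  rewrite [RHS]big_mkcond; apply: eq_bigr => h _; case: ifPn => ch; last first.
    by rewrite big1 // => g; rewrite coprimepMl (negPf ch).
  by rewrite big_distrr /=; apply: eq_bigl => g; rewrite coprimepMl ch.
rewrite big_distrr -sumrB /=; apply: eq_bigr => h _.
rewrite progression_errorE modp_id mulrBr; congr (_ - _); ring.
Qed.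
End BilinearError.

(** * Sums over characters *)

Lemma sum_ord_iota (V : nmodType) n (P : pred nat) (G : nat -> V) :
  \sum_(i < n | P i) G i = \sum_(i <- iota 0 n | P i) G i.
Proof. by rewrite -(big_mkord P G) /index_iota subn0. Qed.

Section CharacterSums.
Variables (R : realType) (F : finFieldType).
Implicit Types (f g h l m d e : {poly F}) (psi chi : {poly F} -> R[i]).
Local Notation normc := Normc.normc.
Local Notation C := (R[i]).
Local Notation q := (#|F|%:R : R).

Lemma pdeg_monic0 m : m \is monic -> pdeg m = 0%N -> m = 1.
Proof.
move=> mm m0; apply/eqP; rewrite -(eqp_monic mm (monic1 _)) -size_poly_eq1.
by rewrite -pdegE ?monic_neq0 // m0.
Qed.

Lemma nprinc_pdeg m i : m \is monic -> (i < phi m)%N -> ~~ princ R m i -> (0 < pdeg m)%N.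
Proof.
move=> mm im; apply: contraNT; rewrite lt0n negbK => /eqP /(pdeg_monic0 mm) e.
apply/asboolP => f _; rewrite (char_modE (g := 1) (dchar_char R mm im)).
  by case: (dchar_char R mm im).
by rewrite e !modp1.
Qed.

Lemma phi_le m : m != 0 -> (phi m <= #|F| ^ pdeg m)%N.
Proof.
move=> m0; rewrite phiE // -size_polys; apply: uniq_leq_size; first exact: resid_uniq.
by move=> r; rewrite mem_resid mem_polys => /andP[].
Qed.

Lemma sum_tau r : \sum_(m <- mons F r) (tau m)%:R / q ^+ r <= r.+1%:R :> R.
Proof.
have q0 : 0 < q ^+ r by rewrite exprn_gt0 // ltr0n ltnW // finNzRing_gt1.
rewrite -big_distrl /= ler_pdivrMr // mulrC.
have := tau_moment F R 1 r; rewrite expn1 /= expr1.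
by under eq_bigr => m _ do rewrite expr1.
Qed.

Lemma sum_inv_phi r : \sum_(m <- mons F r) (phi m)%:R^-1 <= r.+1%:R :> R.
Proof.
apply: le_trans (sum_tau r); rewrite big_seq [leRHS]big_seq; apply: ler_sum => m.
rewrite mem_mons => /andP[mm /eqP <-].
have := inv_phi_mul_le R (monic1 F) mm; rewrite mul1r => /le_trans; apply.
by rewrite ler_piMr ?divr_ge0 ?exprn_ge0 // invf_le1 ?ltr0n ?ler1n ?phi_gt0 ?oner_neq0.
Qed.

(** Conductor and primitive character are chosen as a function, so that its injectivity at fixed m
    can be used for counting. *)
Lemma conductor_data : exists cd : {poly F} * nat -> {poly F} * nat,
  forall m i, m \is monic -> (i < phi m)%N ->
  [/\ is_conductor m (dchar R m i) (cd (m, i)).1, ((cd (m, i)).2 < phi (cd (m, i)).1)%N,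
      primchar R (cd (m, i)).1 (cd (m, i)).2 &
      forall f, coprimep f m -> dchar R m i f = dchar R (cd (m, i)).1 (cd (m, i)).2 f].
Proof.
suff H : forall p : {poly F} * nat, exists x : {poly F} * nat,
   p.1 \is monic -> (p.2 < phi p.1)%N ->
   [/\ is_conductor p.1 (dchar R p.1 p.2) x.1, (x.2 < phi x.1)%N, primchar R x.1 x.2 &
      forall f, coprimep f p.1 -> dchar R p.1 p.2 f = dchar R x.1 x.2 f].
  by have [cd cdP] := choice H; exists cd => m i mm im; exact: (cdP (m, i)).
move=> [m i] /=.
have [mm|mm] := boolP (m \is monic); last by exists (0, 0%N).
have [im|im] := ltnP i (phi m); last by exists (0, 0%N).
have [d cd] := conductor_exists mm (dchar_char R mm im).
have [j [jd pj e]] := conductor_primchar cd.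
by exists (d, j).
Qed.

(** A character mod d e vanishes off the units mod d e, while the primitive character mod d inducing
    it need not; the cutoff by coprimality to e makes up for this. *)
Definition twist psi e f : C := psi f * (coprimep f e)%:R.

Lemma csum_primitive psi n m d e i j : m = d * e -> m \is monic -> d \is monic ->
  (i < phi m)%N -> (j < phi d)%N ->
  (forall f, coprimep f m -> dchar R m i f = dchar R d j f) ->
  csum psi n (dchar R m i) = csum (twist psi e) n (dchar R d j).
Proof.
move=> em mm dm im jd h; apply: eq_bigr => f _; rewrite /twist -mulrA; congr (_ * _).
have [c|c] := boolP (coprimep f m).
  rewrite h //; move: c; rewrite em coprimepMr => /andP[_ ->].
  by rewrite mul1r.
rewrite (char_ncop (dchar_char R mm im) c); move: c; rewrite em coprimepMr negb_and.
case/orP => [c|/negPf ->]; last by rewrite mul0r.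
by rewrite (char_ncop (dchar_char R dm jd) c) mulr0.
Qed.

Definition large_part psi1 psi2 a b (Y : nat) d e : R :=
  if (Y < #|F| ^ pdeg d)%N then
    (phi (d * e))%:R^-1 * \sum_(j < phi d | primchar R d j)
      normc (csum (twist psi1 e) a (dchar R d j)) * normc (csum (twist psi2 e) b (dchar R d j))
  else 0.

Lemma charbound_split psi1 psi2 a b (Y : nat) (T : R) m : m \is monic -> (0 < Y)%N -> 0 <= T ->
  (forall i d, (i < phi m)%N -> ~~ princ R m i -> is_conductor m (dchar R m i) d ->
     (#|F| ^ pdeg d <= Y)%N ->
     normc (csum psi1 a (dchar R m i)) * normc (csum psi2 b (dchar R m i)) <= T) ->
  charbound psi1 psi2 a b m <=
    (phi m)%:R^-1 * ((#|F| * Y ^ 2)%:R * T) +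
    \sum_(d <- divs m) large_part psi1 psi2 a b Y d (m %/ d).
Proof.
move=> mm Y0 T0 hT; have m0 := monic_neq0 mm; have [cd cdP] := conductor_data.
have q1 := finNzRing_gt1 F.
pose Phi i := normc (csum psi1 a (dchar R m i)) * normc (csum psi2 b (dchar R m i)).
pose s := [seq i <- iota 0 (phi m) | ~~ princ R m i].
pose small i := (#|F| ^ pdeg (cd (m, i)).1 <= Y)%N.
have sP i : i \in s -> (i < phi m)%N /\ ~~ princ R m i.
  by rewrite mem_filter mem_iota add0n leq0n /= => /andP[-> ->].
have us : uniq s by rewrite filter_uniq ?iota_uniq.
have cinj : {in s &, injective (fun i => cd (m, i))}.
  move=> i i' /sP[im _] /sP[im' _] e.
  have [_ _ _ h] := cdP m i mm im; have [_ _ _ h'] := cdP m i' mm im'.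
  by apply: (@dchar_inj R F m _ _ mm im im') => f cf; rewrite h // h' // e.
have -> : charbound psi1 psi2 a b m =
   (phi m)%:R^-1 * \sum_(i <- s | small i) Phi i
   + (phi m)%:R^-1 * \sum_(i <- s | ~~ small i) Phi i.
  rewrite -mulrDr /charbound; congr (_ * _).
  transitivity (\sum_(i <- s) Phi i); last exact: bigID.
  by rewrite /s big_filter -(big_mkord (fun i => ~~ princ R m i) Phi) /index_iota subn0.
apply: lerD.
  rewrite ler_wpM2l ?invr_ge0 //.
  apply: (@le_trans _ _ (\sum_(i <- [seq i <- s | small i]) T)).
    rewrite big_filter big_seq_cond [leRHS]big_seq_cond; apply: ler_sum => i /andP[/sP[im np] sm].
    by have [h _ _ _] := cdP m i mm im; exact: hT sm.
  rewrite sum_const_seq -[leLHS]mulr_natl ler_wpM2r // ler_nat.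
  (* With k the integer part of log Y, the small conductors are among q^(k+1) <= q Y polynomials,
     and the indices satisfy j < phi(d) <= |d| <= Y. *)
  pose k := trunc_log #|F| Y.
  have hk : (#|F| ^ k <= Y)%N by apply: trunc_logP.
  apply: (@leq_trans (size [seq (d, j) | d <- polys F k.+1, j <- iota 0 Y])).
    rewrite -(size_map (fun i => cd (m, i))); apply: uniq_leq_size.
      rewrite map_inj_in_uniq; first exact: filter_uniq.
      by apply: sub_in2 cinj => i; rewrite mem_filter => /andP[].
    move=> _ /mapP[i + ->]; rewrite mem_filter => /andP[sm /sP[im _]].
    have [[dm ddm _ _] jd _ _] := cdP m i mm im.
    apply/allpairsP; exists (cd (m, i)); rewrite -surjective_pairing; split => //.
      rewrite mem_polys -pdegE ?monic_neq0 // ltnS; exact: trunc_log_max.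
    rewrite mem_iota add0n /=; apply: leq_trans jd _; apply: leq_trans sm.
    by apply: phi_le; exact: monic_neq0.
  rewrite size_allpairs size_polys size_iota expnS -mulnA leq_mul2l -mulnn leq_mul2r hk.
  by rewrite orbT orbT.
have -> : \sum_(d <- divs m) large_part psi1 psi2 a b Y d (m %/ d) =
  (phi m)%:R^-1 * \sum_(p <- [seq (d, j) | d <- [seq d <- divs m | (Y < #|F| ^ pdeg d)%N],
        j <- [seq j <- iota 0 (phi d) | primchar R d j]])
     (normc (csum (twist psi1 (m %/ p.1)) a (dchar R p.1 p.2))
      * normc (csum (twist psi2 (m %/ p.1)) b (dchar R p.1 p.2))).
  rewrite big_allpairs_dep big_filter big_distrr /= [RHS]big_mkcond.
  apply: eq_big_seq => d; rewrite mem_divs // => /andP[dm ddm].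
  rewrite /large_part; case: ifP => // _.
  rewrite (_ : d * (m %/ d) = m); last by rewrite mulrC divpK.
  congr (_ * _).
  rewrite big_filter (sum_ord_iota _ (fun j => primchar R d j) (fun j => normc
    (csum (twist psi1 (m %/ d)) a (dchar R d j)) * normc (csum (twist psi2 (m %/ d)) b (dchar R d j)))).
  by [].
rewrite ler_wpM2l ?invr_ge0 //.
have -> : \sum_(i <- s | ~~ small i) Phi i =
   \sum_(p <- [seq cd (m, i) | i <- [seq i <- s | ~~ small i]])
     (normc (csum (twist psi1 (m %/ p.1)) a (dchar R p.1 p.2))
      * normc (csum (twist psi2 (m %/ p.1)) b (dchar R p.1 p.2))).
  rewrite big_map big_filter big_seq_cond [RHS]big_seq_cond.
  apply: eq_bigr => i /andP[/sP[im _] _].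
  have [[dm ddm _ _] jd _ h] := cdP m i mm im.
  have em : m = (cd (m, i)).1 * (m %/ (cd (m, i)).1) by rewrite mulrC divpK.
  by rewrite /Phi (csum_primitive psi1 a em mm dm im jd h) (csum_primitive psi2 b em mm dm im jd h).
(* Distinct characters mod m have distinct pairs (conductor, index), and enlarging the sum to all
   pairs with d dividing m and |d| > Y adds only nonnegative terms. *)
apply: big_subset_le.
- rewrite map_inj_in_uniq; first exact: filter_uniq.
  by apply: sub_in2 cinj => i; rewrite mem_filter => /andP[].
- apply: allpairs_uniq_dep; first by apply: filter_uniq; exact: divs_uniq.
    by move=> d _; rewrite filter_uniq ?iota_uniq.
  by move=> [x y] [x' y'] _ _ /= [-> ->].
- move=> _ /mapP[i + ->]; rewrite mem_filter => /andP[sm /sP[im _]].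
  have [[dm ddm _ _] jd pj _] := cdP m i mm im.
  apply/allpairsPdep; exists (cd (m, i)).1, (cd (m, i)).2.
  rewrite -surjective_pairing !mem_filter pj mem_iota add0n jd; split => //.
  apply/and3P; rewrite mem_polys dm ddm; split => //; last exact: dvdp_leq m0 ddm.
  by rewrite ltnNge.
- by move=> p _; rewrite mulr_ge0 ?normc_ge0.
Qed.
End CharacterSums.

(** * Real inequalities: Cauchy-Schwarz and the four-term estimate *)

Section RealBounds.
Variable R : realType.

(* Cauchy-Schwarz in the form needed, obtained from 2uv <= t u^2 + v^2/t at t = P0/U. *)
Lemma cauchy_double (I : Type) (s : seq I) (n : I -> nat) (P : I -> pred nat)
    (w : I -> R) (u v : I -> nat -> R) (U V P0 : R) :
  (forall d, 0 <= w d) -> 0 < U -> 0 < P0 ->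
  \sum_(d <- s) \sum_(j < n d | P d j) u d j ^+ 2 * w d <= U ->
  \sum_(d <- s) \sum_(j < n d | P d j) v d j ^+ 2 * w d <= V ->
  U * V <= P0 ^+ 2 ->
  \sum_(d <- s) w d * \sum_(j < n d | P d j) u d j * v d j <= P0.
Proof.
move=> w0 U0 P00 hU hV hUV; pose t := P0 / U; have t0 : 0 < t by rewrite divr_gt0.
have amgm x y : x * y <= (t * x ^+ 2 + t^-1 * y ^+ 2) / 2.
  rewrite -subr_ge0.
  have -> : (t * x ^+ 2 + t^-1 * y ^+ 2) / 2 - x * y = (t * x - y) ^+ 2 / (2 * t).
    by field; rewrite gt_eqF.
  by rewrite divr_ge0 ?sqr_ge0 // mulr_ge0 // ltW.
apply: (@le_trans _ _ ((t * U + t^-1 * V) / 2)); last first.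
  rewrite ler_pdivrMr // mulrDr mulr1 lerD //; first by rewrite /t divfK ?gt_eqF.
  rewrite /t invf_div mulrAC ler_pdivrMr // -expr2 //.
apply: (@le_trans _ _ ((t * (\sum_(d <- s) \sum_(j < n d | P d j) u d j ^+ 2 * w d) +
   t^-1 * (\sum_(d <- s) \sum_(j < n d | P d j) v d j ^+ 2 * w d)) / 2)); last first.
  by rewrite ler_pM2r ?invr_gt0 // lerD // ler_pM2l ?invr_gt0.
rewrite mulrDl !big_distrr /= !big_distrl -big_split /=; apply: ler_sum => d _.
rewrite !big_distrr /= !big_distrl -big_split /=; apply: ler_sum => j _.
have := amgm (u d j) (v d j) => /(ler_wpM2l (w0 d)) /le_trans; apply.
by apply: eq_ler; ring.
Qed.

(** Applied with al = q^a, be = q^b, S = q^s, X = N^E and Q = q^N. The product expands into four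
    terms, bounded by (Q / X)^2 through X <= S, X^2 <= be, X^2 <= al and S X <= sqrt(Q)
    respectively. *)
Lemma block_numeric (al be S X Q : R) : 0 < al -> 0 < be -> 0 < S -> 0 < X ->
  al * be <= Q -> X <= S -> X ^+ 2 <= al -> X ^+ 2 <= be -> (S * X) ^+ 2 <= Q ->
  (al * (al / S + S)) * (be * (be / S + S)) <= 4 * (Q / X) ^+ 2.
Proof.
move=> a0 b0 S0 X0 abQ XS Xa Xb SXQ.
have ab0 : 0 < al * be by exact: mulr_gt0.
have Q0 : 0 < Q by exact: lt_le_trans abQ.
have X20 : 0 < X ^+ 2 by exact: exprn_gt0.
have ab2 : (al * be) ^+ 2 <= Q ^+ 2 by rewrite lerXn2r ?nnegrE ?(ltW ab0) ?(ltW Q0).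
have t1 : (al * be) ^+ 2 / S ^+ 2 <= Q ^+ 2 / X ^+ 2.
  rewrite ler_pM ?invr_ge0 ?exprn_ge0 ?(ltW S0) ?(ltW ab0) //.
  by rewrite lef_pV2 ?posrE ?exprn_gt0 // lerXn2r ?nnegrE ?(ltW S0) ?(ltW X0).
have t2 : (al * be) ^+ 2 / be <= Q ^+ 2 / X ^+ 2.
  by rewrite ler_pM ?invr_ge0 ?exprn_ge0 ?(ltW b0) ?(ltW ab0) // lef_pV2 ?posrE.
have t3 : (al * be) ^+ 2 / al <= Q ^+ 2 / X ^+ 2.
  by rewrite ler_pM ?invr_ge0 ?exprn_ge0 ?(ltW a0) ?(ltW ab0) // lef_pV2 ?posrE.
have t4 : al * be * S ^+ 2 <= Q ^+ 2 / X ^+ 2.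
  rewrite ler_pdivlMr //.
  have -> : al * be * S ^+ 2 * X ^+ 2 = (al * be) * (S * X) ^+ 2 by ring.
  rewrite [Q ^+ 2]expr2.
  by apply: ler_pM => //; rewrite ?exprn_ge0 ?mulr_ge0 ?ltW.
have -> : (al * (al / S + S)) * (be * (be / S + S)) =
   (al * be) ^+ 2 / S ^+ 2 + (al * be) ^+ 2 / be + (al * be) ^+ 2 / al + al * be * S ^+ 2.
  by field; rewrite !gt_eqF.
have -> : 4 * (Q / X) ^+ 2 = Q ^+ 2 / X ^+ 2 + Q ^+ 2 / X ^+ 2 + Q ^+ 2 / X ^+ 2 + Q ^+ 2 / X ^+ 2.
  by rewrite exprMn exprVn; ring.
by rewrite !lerD.
Qed.

End RealBounds.

(** * Siegel-Walfisz in powers of N, and the total over large conductors *)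

Section Estimates.
Variables (R : realType) (F : finFieldType).
Implicit Types (f g h l m d e : {poly F}) (psi chi : {poly F} -> R[i]).
Local Notation normc := Normc.normc.
Local Notation C := (R[i]).
Local Notation q := (#|F|%:R : R).

Lemma q_gt0 : 0 < q. Proof. by rewrite ltr0n ltnW // finNzRing_gt1. Qed.
Lemma q_ge1 : 1 <= q. Proof. by rewrite ler1n ltnW // finNzRing_gt1. Qed.

(** Taking D = D0 + k + G admits conductors up to N^k and saves at least N^G at once. The condition
    N <= 4a is met by the larger of two degrees with sum above N/2, and N >= 16 gives a >= 4 for
    [siegel_walfisz_level]. *)
Lemma siegel_walfisz_power psi (k G : nat) : siegel_walfisz psi ->
  exists2 K : R, 0 <= K & forall N a m d chi, (16 <= N)%N -> (N <= 4 * a)%N ->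
    (0 < pdeg m)%N -> character_mod m chi -> ~ principal_mod m chi ->
    is_conductor m chi d -> (#|F| ^ pdeg d <= N ^ k)%N ->
    normc (csum psi a chi) <= K * (q ^+ a / N%:R ^+ G).
Proof.
move=> /siegel_walfisz_csum[D0 D00 h]; pose D := D0 + k%:R + G%:R.
have D0D : D0 <= D by rewrite /D -addrA lerDl addr_ge0.
have Dge0 : 0 <= D by apply: le_trans D0D; exact: ltW.
have D2D : D0 <= 2 * D by apply: le_trans D0D _; rewrite ler_peMl // ler1n.
have [K K0 hK] := h (2 * D) D2D.
exists (K * 4 `^ (6 * D)); first by rewrite mulr_ge0 ?powR_ge0.
move=> N a m d chi N16 Na m0 ch np cd hd.
have N0 : (0 < N)%N by exact: leq_trans N16.
have a4 : (4 <= a)%N by rewrite -(leq_pmul2l (isT : 0 < 4)%N) (leq_trans N16).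
have a0 : (0 < a)%N by exact: leq_trans a4.
have [l1 l2] := @siegel_walfisz_level R F D 4 a N Dge0 Na a4 isT N0.
have N1 : 1 <= N%:R :> R by rewrite ler1n.
have lnN : 0 <= ln (N%:R : R) by rewrite ln_ge0.
have lq := ln_card_gt0 R F.
apply: le_trans (hK a m d chi a0 m0 ch np cd _) _.
  apply: le_trans l1; rewrite /logq mulrA ler_pdivlMr //.
  apply: (@le_trans _ _ (k%:R * ln N%:R)); last first.
    by rewrite ler_wpM2r // /D -addrA addrCA lerDl addr_ge0 // ltW.
  rewrite !mulr_natl -!lnXn ?ltr0n ?(ltnW (finNzRing_gt1 F)) //.
  by rewrite ler_ln ?posrE ?exprn_gt0 ?ltr0n ?(ltnW (finNzRing_gt1 F)) // -!natrX ler_nat.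
rewrite -mulrA ler_wpM2l // [leRHS]mulrCA ler_wpM2l ?exprn_ge0 //.
apply: le_trans l2 _; rewrite ler_wpM2l ?powR_ge0 //.
rewrite lef_pV2 ?posrE ?powR_gt0 ?exprn_gt0 ?ltr0n //; apply: powR_ge_exp => //.
have -> : 6 * D = G%:R + (5 * D + (D0 + k%:R)) by rewrite /D; ring.
by rewrite lerDl addr_ge0 ?mulr_ge0 // addr_ge0 // ltW.
Qed.

(** The left side is the large sieve factor q^(L - s) for the shortest admissible L, which must
    exceed a and be at least 2s. *)
Lemma sieve_exponent a s :
  q ^+ (maxn a.+1 (s + s) - s) <= q * (q ^+ a / q ^+ s + q ^+ s).
Proof.
have Sq : 0 < q ^+ s by rewrite exprn_gt0 ?q_gt0.
have aq : 0 < q ^+ a by rewrite exprn_gt0 ?q_gt0.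
have [h|h] := leqP a.+1 (s + s).
  rewrite addKn; apply: (@le_trans _ _ (1 * (q ^+ s))); first by rewrite mul1r.
  by rewrite ler_pM ?q_ge1 ?(ltW Sq) // lerDr ltW // divr_gt0.
have sa : (s <= a.+1)%N.
  by apply: leq_trans (ltnW h); rewrite leq_addr.
apply: (@le_trans _ _ (q * (q ^+ a / q ^+ s))).
  by rewrite mulrA -exprS ler_pdivlMr // -exprD subnK.
by rewrite ler_wpM2l ?(ltW q_gt0) // lerDl ltW.
Qed.

(** The large sieve applies to each of psi1 and psi2 over conductors of degree s; Cauchy-Schwarz
    combines the two and [block_numeric] evaluates the product. Twisting by e does not increase
    second moments, so the bound is uniform in e. *)
Lemma large_block psi1 psi2 a b s e (M Q X : R) : 0 < M -> 0 < X ->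
  \sum_(f <- mons F a) normc (psi1 f) ^+ 2 <= M * q ^+ a ->
  \sum_(f <- mons F b) normc (psi2 f) ^+ 2 <= M * q ^+ b ->
  q ^+ a * q ^+ b <= Q -> X <= q ^+ s -> X ^+ 2 <= q ^+ a -> X ^+ 2 <= q ^+ b ->
  (q ^+ s * X) ^+ 2 <= Q ->
  \sum_(d <- mons F s) (phi d)%:R^-1 * \sum_(j < phi d | primchar R d j)
      normc (csum (twist psi1 e) a (dchar R d j)) * normc (csum (twist psi2 e) b (dchar R d j))
  <= 2 * q * M * (Q / X).
Proof.
move=> M0 X0 h1 h2 abQ XS Xa Xb SXQ; have q0 := q_gt0.
have Q0 : 0 < Q by apply: lt_le_trans abQ; rewrite mulr_gt0 ?exprn_gt0.
have tw psi n : \sum_(f <- mons F n) normc (twist psi e f) ^+ 2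
                <= \sum_(f <- mons F n) normc (psi f) ^+ 2.
  apply: ler_sum => f _; rewrite /twist Normc.normcM normc_nat exprMn.
  by case: (coprimep _ _); rewrite ?expr1n ?mulr1 // expr0n mulr0 sqr_ge0.
have ls psi n (hn : \sum_(f <- mons F n) normc (psi f) ^+ 2 <= M * q ^+ n) :
  \sum_(d <- mons F s) \sum_(j < phi d | primchar R d j)
     normc (csum (twist psi e) n (dchar R d j)) ^+ 2 * (phi d)%:R^-1
  <= q * (q ^+ n / q ^+ s + q ^+ s) * (M * q ^+ n).
  apply: le_trans (large_sieve (L := maxn n.+1 (s + s)) _ _ _) _.
  - exact: leq_maxr.
  - exact: leq_maxl.
  apply: ler_pM; rewrite ?exprn_ge0 ?(ltW q0) ?sieve_exponent //.
    by apply: sumr_ge0 => f _; exact: sqr_ge0.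
  exact: le_trans (tw _ _) hn.
apply: (@cauchy_double _ _ _ (fun d => phi d) (fun d => primchar R d) (fun d => (phi d)%:R^-1)
   (fun d j => normc (csum (twist psi1 e) a (dchar R d j)))
   (fun d j => normc (csum (twist psi2 e) b (dchar R d j))) _ _ _ _ _ _ (ls _ _ h1) (ls _ _ h2)).
- by move=> d; rewrite invr_ge0.
- by rewrite !mulr_gt0 ?addr_gt0 ?divr_gt0 ?exprn_gt0.
- by rewrite !mulr_gt0 ?invr_gt0.
have := block_numeric _ _ _ X0 abQ XS Xa Xb SXQ; rewrite !exprn_gt0 // => /(_ isT isT isT).
move=> /(ler_wpM2l (sqr_ge0 (q * M))) => hh.
by apply: le_trans (le_trans _ hh) _; apply: eq_ler; ring.
Qed.

(** Writing m = d e with deg d = s, the inequality 1 / phi(d e) <= tau(e) / (|e| phi(d)) frees the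
    sum over d from e. One factor r + 1 bounds the sum of tau(e) / |e|, the other counts the degrees
    s. *)
Lemma large_total psi1 psi2 a b (Y r : nat) (P0 : R) : 0 <= P0 ->
  (forall s e, (s <= r)%N -> (Y < #|F| ^ s)%N ->
   \sum_(d <- mons F s) (phi d)%:R^-1 * \sum_(j < phi d | primchar R d j)
      normc (csum (twist psi1 e) a (dchar R d j)) * normc (csum (twist psi2 e) b (dchar R d j))
    <= P0) ->
  \sum_(m <- mons F r) \sum_(d <- divs m) large_part psi1 psi2 a b Y d (m %/ d)
  <= r.+1%:R ^+ 2 * P0.
Proof.
move=> P00 hb; rewrite sum_mons_divs.
apply: (@le_trans _ _ (\sum_(s < r.+1) r.+1%:R * P0)); last first.
  by rewrite sumr_const card_ord -[leLHS]mulr_natl mulrA expr2.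
apply: ler_sum => s _; have sr : (s <= r)%N by rewrite -ltnS.
rewrite exchange_big /=.
have [h|h] := ltnP Y (#|F| ^ s); last first.
  rewrite big1_seq ?mulr_ge0 // => e _; rewrite big1_seq // => d /andP[_].
  rewrite mem_mons => /andP[_ /eqP pd].
  by rewrite /large_part pd ltnNge h.
apply: (@le_trans _ _ (\sum_(e <- mons F (r - s)) (tau e)%:R / q ^+ (r - s) * P0)).
  rewrite big_seq [leRHS]big_seq; apply: ler_sum => e; rewrite mem_mons => /andP[em /eqP pe].
  apply: (@le_trans _ _ ((tau e)%:R / q ^+ (r - s) *
     \sum_(d <- mons F s) (phi d)%:R^-1 * \sum_(j < phi d | primchar R d j)
      normc (csum (twist psi1 e) a (dchar R d j)) * normc (csum (twist psi2 e) b (dchar R d j)))).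
    rewrite big_distrr /= big_seq [leRHS]big_seq; apply: ler_sum => d.
    rewrite mem_mons => /andP[dm /eqP pd]; rewrite /large_part pd h mulrA.
    rewrite ler_wpM2r ?sumr_ge0 //; first by move=> j _; rewrite mulr_ge0 ?normc_ge0.
    by rewrite -pe; exact: inv_phi_mul_le.
  by rewrite ler_wpM2l ?hb // divr_ge0 ?exprn_ge0.
rewrite -big_distrl /= ler_wpM2r //; apply: le_trans (sum_tau _ _ _) _.
by rewrite ler_nat ltnS leq_subr.
Qed.
End Estimates.

(** * Equidistribution *)

Section BombieriVinogradov.
Variables (R : realType) (F : finFieldType).
Implicit Types (f g h l m d : {poly F}) (psi chi : {poly F} -> R[i]).
Local Notation normc := Normc.normc.
Local Notation q := (#|F|%:R : R).

Definition maxerr psi N m : R :=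
  \big[Num.max/0]_(M < N.+1) \big[Num.max/0]_(l : {poly_(pdeg m) F} | coprimep m l)
    normc (progression_error psi M m l).

Lemma maxerr_ge0 psi N m : 0 <= maxerr psi N m.
Proof. exact: bigmax_ge_id. Qed.

Lemma maxerr_ge psi N M m l : (M <= N)%N -> (size l <= pdeg m)%N -> coprimep m l ->
  normc (progression_error psi M m l) <= maxerr psi N m.
Proof.
move=> MN sl cl; have MN' : (M < N.+1)%N by [].
apply: le_trans (le_bigmax _ _ (Ordinal MN')) => /=.
have el : l = npolyp (pdeg m) l :> {poly F} by rewrite npolypK.
rewrite {1}el; apply: (le_bigmax_cond 0 (fun l0 : {poly_(pdeg m) F} =>
  normc (progression_error psi M m l0))).
by rewrite -el.
Qed.

Lemma maxerr_le psi N m V : 0 <= V ->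
  (forall M l, (M <= N)%N -> coprimep m l -> normc (progression_error psi M m l) <= V) ->
  maxerr psi N m <= V.
Proof.
move=> V0 h; apply: bigmax_le => // M _; apply: bigmax_le => // l cl.
by apply: h; rewrite // -ltnS.
Qed.

Definition mods N (B : R) := [seq m <- polys F N.+1 |
  (m \is monic) && ((pdeg m)%:R <= N%:R / 2 - B * logq F N%:R)].

Lemma modsP N B m : m \in mods N B -> m \is monic.
Proof. by rewrite mem_filter => /andP[/andP[]]. Qed.

Lemma sum_mods N B (G : {poly F} -> R) :
  \sum_(m : {poly_N.+1 F} | ((m : {poly F}) \is monic)
     && ((pdeg m)%:R <= N%:R / 2 - B * logq F N%:R)) G m = \sum_(m <- mods N B) G m.
Proof.
by rewrite big_filter (big_npoly _ _ (fun m => (m \is monic) &&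
  ((pdeg m)%:R <= N%:R / 2 - B * logq F N%:R))).
Qed.

Lemma logq_ge0 N : (0 < N)%N -> 0 <= logq F (N%:R : R).
Proof. by move=> N0; rewrite divr_ge0 ?ln_ge0 ?ler1n ?(ltW (ln_card_gt0 _ _)) // ltnW // finNzRing_gt1. Qed.

Lemma sum_mods_le N B B' (G : {poly F} -> R) : (0 < N)%N -> B' <= B ->
  (forall m, m \is monic -> 0 <= G m) ->
  \sum_(m <- mods N B) G m <= \sum_(m <- mods N B') G m.
Proof.
move=> N0 BB G0; apply: big_subset_le; rewrite ?filter_uniq ?polys_uniq //.
  move=> m; rewrite !mem_filter => /andP[/andP[-> h] ->]; rewrite andbT /=.
  by apply: le_trans h _; rewrite lerD2l lerN2 ler_wpM2r ?logq_ge0.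
by move=> m /modsP /G0.
Qed.

(* A form of r <= N/2 - e log N without logarithms. *)
Definition good N e r : bool := (q ^+ r * N%:R ^+ e) ^+ 2 <= q ^+ N.

Lemma mods_good N B e m : (0 < N)%N -> e%:R <= B -> m \in mods N B -> good N e (pdeg m).
Proof.
move=> N0 eB; rewrite mem_filter => /andP[/andP[_ h] _].
have lq := ln_card_gt0 R F; have q0 := q_gt0 R F.
have x0 : 0 < N%:R :> R by rewrite ltr0n.
have lx : 0 <= ln (N%:R : R) by rewrite ln_ge0 // ler1n.
rewrite /good -ler_ln ?posrE ?exprn_gt0 ?mulr_gt0 ?exprn_gt0 //.
rewrite !lnXn ?mulr_gt0 ?exprn_gt0 // lnM ?posrE ?exprn_gt0 // !lnXn //.
rewrite -[leRHS]mulr_natl -[leLHS]mulr_natl -[_ *+ pdeg m]mulr_natl -[_ *+ e]mulr_natl.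
move: h; rewrite /logq mulrA => h.
have := ler_wpM2r (ltW lq) h; rewrite mulrBl divfK ?gt_eqF // => h2.
have h3 : e%:R * ln N%:R <= B * ln N%:R :> R by rewrite ler_wpM2r.
have h4 : N%:R / 2 * ln q = (N%:R * ln q) / 2 by ring.
rewrite h4 in h2; clear -h2 h3; lra.
Qed.

Lemma sum_mods_good N B e (G : {poly F} -> R) : (0 < N)%N -> e%:R <= B ->
  (forall m, m \is monic -> 0 <= G m) ->
  \sum_(m <- mods N B) G m <= \sum_(r < N.+1 | good N e r) \sum_(m <- mons F r) G m.
Proof.
move=> N0 eB G0.
have -> : \sum_(r < N.+1 | good N e r) \sum_(m <- mons F r) G m =
   \sum_(m <- [seq m <- polys F N.+1 | (m \is monic) && good N e (pdeg m)]) G m.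
  rewrite big_filter big_mkcondr /= sum_monic_split big_mkcond /=.
  apply: eq_bigr => r _; case: ifP => gr.
    by apply: eq_big_seq => m; rewrite mem_mons => /andP[_ /eqP ->]; rewrite gr.
  by rewrite big1_seq // => m; rewrite mem_mons => /andP[_ /andP[_ /eqP ->]]; rewrite gr.
apply: big_subset_le; rewrite ?filter_uniq ?polys_uniq //.
  move=> m hm; have g := mods_good N0 eB hm; have mm := modsP hm.
  by move: hm; rewrite !mem_filter g mm => /andP[_ ->].
by move=> m; rewrite mem_filter => /andP[/andP[/G0]].
Qed.

Lemma level_moments psi : growth_condition psi ->
  exists c : nat, exists2 K0 : R, 0 <= K0 &
  forall c' K N n, (c <= c')%N -> K0 <= K -> (0 < N)%N -> (n <= N)%N ->
    \sum_(f <- mons F n) normc (psi f) <= K * (q ^+ n * N%:R ^+ c') /\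
    \sum_(f <- mons F n) normc (psi f) ^+ 2 <= K * (q ^+ n * N%:R ^+ c').
Proof.
move=> /growth_moments[c [K0 K00 h]]; exists c; exists (K0 * 2 ^+ c).
  by rewrite mulr_ge0 ?exprn_ge0.
move=> c' K N n cc KK N0 nN; have [h1 h2] := h n.
have q0 := q_gt0 R F; have N1 : 1 <= N%:R :> R by rewrite ler1n.
suff le : K0 * (q ^+ n * n.+1%:R ^+ c) <= K * (q ^+ n * N%:R ^+ c').
  by split; [apply: le_trans h1 le | apply: le_trans h2 le].
apply: (@le_trans _ _ (K0 * 2 ^+ c * (q ^+ n * N%:R ^+ c'))); last first.
  by rewrite ler_wpM2r ?mulr_ge0 ?exprn_ge0 ?(ltW q0).
rewrite -mulrA ler_wpM2l // [leRHS]mulrCA ler_wpM2l ?exprn_ge0 ?(ltW q0) //.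
apply: (@le_trans _ _ ((2 * N%:R) ^+ c)).
  by rewrite lerXn2r ?nnegrE ?mulr_ge0 // -natrM ler_nat; clear -N0 nN; lia.
by rewrite exprMn ler_wpM2l ?exprn_ge0 //; exact: ler_weXn2l.
Qed.

Lemma pow_absorb (x : R) (k A e : nat) : 1 <= x -> (k + A <= e)%N ->
  x ^+ k / x ^+ e <= (x ^+ A)^-1.
Proof.
move=> x1 kAe; have x0 : 0 < x by exact: lt_le_trans x1.
rewrite ler_pdivrMr ?exprn_gt0 // mulrC ler_pdivlMr ?exprn_gt0 // -exprD.
exact: ler_weXn2l.
Qed.

Lemma succ_le2 N : (0 < N)%N -> N.+1%:R <= 2 * N%:R :> R.
Proof. by move=> N0; rewrite -natrM ler_nat; lia. Qed.

(** For a + b <= N/2 the trivial bound suffices: q^r moduli of degree r, with q^r <= q^(N/2) / N^e,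
    give q^N / N^e, and N^e pays for the moments, for the sum over r and for N^A. *)
Lemma case_trivial_short (c A e N a b : nat) (K S : R) : 0 <= K -> (0 < N)%N ->
  (2 * c + 1 + A <= e)%N -> (2 * (a + b) <= N)%N ->
  0 <= S -> S <= 2 * (K ^+ 2 * (q ^+ (a + b) * N%:R ^+ (2 * c))) ->
  \sum_(r < N.+1 | good N e r) \sum_(m <- mons F r) S
  <= 4 * K ^+ 2 * (q ^+ N / N%:R ^+ A).
Proof.
move=> K0 N0 he hab S0 hS; have q0 := q_gt0 R F; have q1 := q_ge1 R F.
have N1 : 1 <= N%:R :> R by rewrite ler1n.
have x0 : 0 < N%:R :> R by rewrite ltr0n.
pose Z : R := 2 * (K ^+ 2 * (q ^+ N / N%:R ^+ e * N%:R ^+ (2 * c))).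
have Z0 : 0 <= Z by rewrite !mulr_ge0 ?invr_ge0 ?exprn_ge0 ?(ltW q0).
apply: (@le_trans _ _ (\sum_(r < N.+1) Z)).
  rewrite big_mkcond; apply: ler_sum => r _; case: ifP => // gr.
  rewrite sum_const_seq size_mons -[leLHS]mulr_natl natrX.
  apply: (@le_trans _ _ (q ^+ r * (2 * (K ^+ 2 * (q ^+ (a + b) * N%:R ^+ (2 * c)))))).
    by rewrite ler_wpM2l ?exprn_ge0 ?(ltW q0).
  have key : q ^+ r * q ^+ (a + b) <= q ^+ N / N%:R ^+ e.
    rewrite ler_pdivlMr ?exprn_gt0 //.
    have p0 : 0 <= q ^+ r * q ^+ (a + b) * N%:R ^+ e.
      by rewrite !mulr_ge0 ?exprn_ge0 ?(ltW q0).
    rewrite -(@ler_pXn2r _ 2) ?nnegrE ?exprn_ge0 ?(ltW q0) //.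
    rewrite mulrAC exprMn [leRHS]expr2 ler_pM ?exprn_ge0 ?mulr_ge0 ?exprn_ge0 ?(ltW q0) //.
    by rewrite -exprM; apply: ler_weXn2l; rewrite // mulnC.
  rewrite /Z; apply: (@le_trans _ _ (2 * K ^+ 2 * N%:R ^+ (2 * c) * (q ^+ r * q ^+ (a + b)))).
    by apply: eq_ler; ring.
  apply: (@le_trans _ _ (2 * K ^+ 2 * N%:R ^+ (2 * c) * (q ^+ N / N%:R ^+ e))).
    by rewrite ler_wpM2l ?mulr_ge0 ?exprn_ge0.
  by apply: eq_ler; ring.
rewrite sumr_const card_ord -[leLHS]mulr_natl.
apply: (@le_trans _ _ (2 * N%:R * Z)); first by rewrite ler_wpM2r ?succ_le2.
apply: (@le_trans _ _ (4 * K ^+ 2 * q ^+ N * (N%:R ^+ (2 * c + 1) / N%:R ^+ e))).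
  by apply: eq_ler; rewrite /Z exprD expr1; ring.
rewrite [leRHS]mulrA ler_wpM2l ?mulr_ge0 ?exprn_ge0 ?(ltW q0) //.
exact: pow_absorb.
Qed.

Lemma case_trivial_small (c A e N a b : nat) (K S : R) : 0 <= K -> (0 < N)%N ->
  (N < 16)%N -> (a + b <= N)%N ->
  0 <= S -> S <= 2 * (K ^+ 2 * (q ^+ (a + b) * N%:R ^+ (2 * c))) ->
  \sum_(r < N.+1 | good N e r) \sum_(m <- mons F r) S
  <= 32 * q ^+ 16 * K ^+ 2 * 16 ^+ (2 * c) * 16 ^+ A * (q ^+ N / N%:R ^+ A).
Proof.
move=> K0 N0 N16 hab S0 hS; have q0 := q_gt0 R F; have q1 := q_ge1 R F.
have x0 : 0 < N%:R :> R by rewrite ltr0n.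
have x16 : N%:R <= 16 :> R by rewrite ler_nat ltnW.
have hS2 : S <= 2 * (K ^+ 2 * (q ^+ N * 16 ^+ (2 * c))).
  apply: le_trans hS _; rewrite ler_wpM2l // ler_wpM2l ?exprn_ge0 //.
  apply: ler_pM; rewrite ?exprn_ge0 ?(ltW q0) //; first exact: ler_weXn2l.
  by rewrite lerXn2r ?nnegrE.
have U0 : 0 <= q ^+ 16 * S by rewrite mulr_ge0 ?exprn_ge0 ?(ltW q0).
apply: (@le_trans _ _ (\sum_(r < N.+1) q ^+ 16 * S)).
  rewrite big_mkcond; apply: ler_sum => r _; case: ifP => // gr.
  rewrite sum_const_seq size_mons -[leLHS]mulr_natl natrX ler_wpM2r //.
  by apply: ler_weXn2l => //; apply: leq_trans (ltnW (ltn_ord r)) _.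
rewrite sumr_const card_ord -[leLHS]mulr_natl.
apply: (@le_trans _ _ (16 * (q ^+ 16 * (2 * (K ^+ 2 * (q ^+ N * 16 ^+ (2 * c))))))).
  rewrite ler_pM //; first by rewrite ler_nat.
  by rewrite ler_wpM2l ?exprn_ge0 ?(ltW q0).
have h1 : 1 <= 16 ^+ A / N%:R ^+ A :> R.
  by rewrite ler_pdivlMr ?exprn_gt0 // mul1r lerXn2r ?nnegrE // ltW.
have W0 : 0 <= 16 * (q ^+ 16 * (2 * (K ^+ 2 * (q ^+ N * 16 ^+ (2 * c))))).
  by rewrite !mulr_ge0 ?exprn_ge0 ?(ltW q0).
apply: le_trans (_ : _ <= _ * (16 ^+ A / N%:R ^+ A)) _; first exact: ler_peMr W0 h1.
by apply: eq_ler; ring.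
Qed.

Lemma bv_maxerr psi (k : nat) : bombieri_vinogradov psi ->
  exists2 B0 : R, 0 < B0 & exists2 K : R, 0 <= K & forall N B, (0 < N)%N -> B0 <= B ->
    \sum_(m <- mods N B) maxerr psi N m <= K * (q ^+ N / N%:R ^+ k).
Proof.
(* The exponent k + 1 is used because the hypothesis needs a positive one and k may be 0. *)
move=> /(_ k.+1%:R (ltr0Sn _ _))[B0 B00 [K hK]]; exists B0 => //; exists `|K| => // N B N0 BB.
have N1 : 1 <= N%:R :> R by rewrite ler1n.
apply: le_trans (sum_mods_le N0 BB (fun m _ => maxerr_ge0 psi N m)) _.
have := hK N N0; rewrite (sum_mods N B0 (fun m => maxerr psi N m)) => h.
apply: le_trans h _; apply: (@le_trans _ _ (`|K| * (q ^+ N / N%:R `^ k.+1%:R))).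
  by rewrite ler_wpM2r ?ler_norm // divr_ge0 ?powR_ge0 ?exprn_ge0.
rewrite powR_mulrn // !ler_wpM2l ?exprn_ge0 // lef_pV2 ?posrE ?exprn_gt0 ?ltr0n //.
exact: ler_weXn2l.
Qed.

(** When q^b <= N^C the total mass of psi2 in degree b is O(N^(C + c)), so equidistribution of psi1
    with exponent C + c + A, applied for each h, is enough. *)
Lemma case_small psi1 psi2 (c C A N a b : nat) (B K K1 : R) : 0 <= K -> (0 < N)%N ->
  (a <= N)%N -> 0 <= K1 ->
  \sum_(m <- mods N B) maxerr psi1 N m <= K1 * (q ^+ N / N%:R ^+ (C + c + A)) ->
  \sum_(h <- mons F b) normc (psi2 h) <= K * (q ^+ b * N%:R ^+ c) ->
  (#|F| ^ b <= N ^ C)%N ->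
  exists V : {poly F} -> R, [/\ forall m, m \is monic -> 0 <= V m,
    forall m l, m \is monic -> coprimep l m ->
      normc (bilinear_error psi1 psi2 a b m l) <= V m &
    \sum_(m <- mods N B) V m <= K * K1 * (q ^+ N / N%:R ^+ A)].
Proof.
move=> K0 N0 aN K10 hB hS hb; have q0 := q_gt0 R F.
have N1 : 1 <= N%:R :> R by rewrite ler1n.
pose S := \sum_(h <- mons F b) normc (psi2 h).
have S0 : 0 <= S by apply: sumr_ge0 => h _; exact: normc_ge0.
exists (fun m => S * maxerr psi1 N m); split.
- by move=> m _; rewrite mulr_ge0 ?maxerr_ge0.
- move=> m l mm cl; have [l' [hl' ->]] := bilinear_error_prog psi1 psi2 a b mm cl.
  apply: le_trans (normc_sum _ _ _) _; rewrite /S big_distrl /= big_mkcond.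
  apply: ler_sum => h _; case: ifP => ch; last by rewrite mulr_ge0 ?normc_ge0 ?maxerr_ge0.
  have [c1 s1] := hl' h ch.
  rewrite Normc.normcM ler_wpM2l ?normc_ge0 //; apply: maxerr_ge => //.
  by rewrite coprimep_sym.
rewrite -big_distrr /=.
have hS2 : S <= K * N%:R ^+ (C + c).
  apply: le_trans hS _; rewrite ler_wpM2l // exprD ler_wpM2r ?exprn_ge0 //.
  by rewrite -!natrX ler_nat.
apply: le_trans (ler_pM S0 _ hS2 hB) _.
  by apply: sumr_ge0 => m _; exact: maxerr_ge0.
apply: (@le_trans _ _ (K * K1 * q ^+ N * (N%:R ^+ (C + c) / N%:R ^+ (C + c + A)))).
  by apply: eq_ler; ring.
rewrite [leRHS]mulrA ler_wpM2l ?mulr_ge0 ?exprn_ge0 ?(ltW q0) //.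
exact: pow_absorb.
Qed.

Lemma charbound_ge0 psi1 psi2 a b m : 0 <= charbound psi1 psi2 a b m.
Proof.
by rewrite mulr_ge0 ?invr_ge0 //; apply: sumr_ge0 => i _; rewrite mulr_ge0 ?normc_ge0.
Qed.

(** The bilinear range, with X = N^E. Large conductors cost N^c from the moments and N^3 from
    [large_total] and the sum over r, against the saving N^E; hence E = A + c + 3. Small conductors
    cost N^(2E) for their number, N^c and N^2 more, against N^G; hence G. The choice C = 2E says
    q^a, q^b > X^2, and E <= e gives q^s X <= q^(N/2). *)
Lemma case_main psi1 psi2 (c A E C G e N a b : nat) (K Ks : R) :
  0 < K -> 0 <= Ks -> (16 <= N)%N -> (a + b <= N)%N -> (N < 2 * (a + b))%N ->
  (E = A + c + 3)%N -> (C = 2 * E)%N -> (G = 2 * E + c + 2 + A)%N -> (E <= e)%N ->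
  \sum_(f <- mons F a) normc (psi1 f) <= K * (q ^+ a * N%:R ^+ c) ->
  \sum_(f <- mons F a) normc (psi1 f) ^+ 2 <= K * (q ^+ a * N%:R ^+ c) ->
  \sum_(f <- mons F b) normc (psi2 f) <= K * (q ^+ b * N%:R ^+ c) ->
  \sum_(f <- mons F b) normc (psi2 f) ^+ 2 <= K * (q ^+ b * N%:R ^+ c) ->
  (forall m d chi, (0 < pdeg m)%N -> character_mod m chi -> ~ principal_mod m chi ->
    is_conductor m chi d -> (#|F| ^ pdeg d <= N ^ E)%N ->
    ((N <= 4 * a)%N -> normc (csum psi1 a chi) <= Ks * (q ^+ a / N%:R ^+ G)) /\
    ((N <= 4 * b)%N -> normc (csum psi2 b chi) <= Ks * (q ^+ b / N%:R ^+ G))) ->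
  (N ^ C < #|F| ^ a)%N -> (N ^ C < #|F| ^ b)%N ->
  \sum_(r < N.+1 | good N e r) \sum_(m <- mons F r) charbound psi1 psi2 a b m
  <= (4 * q * (Ks * K) + 16 * q * K) * (q ^+ N / N%:R ^+ A).
Proof.
move=> K0 Ks0 N16 abN Nab hE hC hG Ee ha ha2 hb hb2 sw hCa hCb.
have N0 : (0 < N)%N by exact: leq_trans N16.
have q0 := q_gt0 R F; have q1 := q_ge1 R F.
have N1 : 1 <= N%:R :> R by rewrite ler1n.
have x0 : 0 < N%:R :> R by rewrite ltr0n.
have [T eT] : exists T : R, T = Ks * K * (q ^+ N * N%:R ^+ c / N%:R ^+ G) by eexists.
have T0 : 0 <= T by rewrite eT !mulr_ge0 ?invr_ge0 ?exprn_ge0 ?(ltW K0) ?(ltW q0).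
have [P0 eP0] : exists P0 : R, P0 = 2 * q * (K * N%:R ^+ c) * (q ^+ N / N%:R ^+ E) by eexists.
have P00 : 0 <= P0 by rewrite eP0 !mulr_ge0 ?invr_ge0 ?exprn_ge0 ?(ltW K0) ?(ltW q0).
have qab : q ^+ a * q ^+ b <= q ^+ N by rewrite -exprD; exact: ler_weXn2l.
have hT m i d : m \is monic -> (i < phi m)%N -> ~~ princ R m i ->
    is_conductor m (dchar R m i) d -> (#|F| ^ pdeg d <= N ^ E)%N ->
    normc (csum psi1 a (dchar R m i)) * normc (csum psi2 b (dchar R m i)) <= T.
  move=> mm im np cd hd; have m0 := monic_neq0 mm; have ch := dchar_char R mm im.
  have np' : ~ principal_mod m (dchar R m i) by apply/asboolPn.
  have [s1 s2] := sw m d _ (nprinc_pdeg mm im np) ch np' cd hd.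
  have t1 := le_trans (normc_csum psi1 a m0 ch) ha.
  have t2 := le_trans (normc_csum psi2 b m0 ch) hb.
  have W : Ks * K * (q ^+ a * q ^+ b) * (N%:R ^+ c / N%:R ^+ G) <= T.
    rewrite eT -[q ^+ N * _ / _]mulrA [leRHS]mulrA ler_wpM2r ?divr_ge0 ?exprn_ge0 //.
    by rewrite ler_wpM2l // mulr_ge0 // ltW.
  (* As a + b > N/2, the larger degree exceeds N/4 and takes the Siegel-Walfisz bound; the other
     takes the trivial one. *)
  have [hab|hab] := leqP b a.
    have h4 : (N <= 4 * a)%N by clear -Nab hab; lia.
    apply: le_trans (ler_pM _ _ (s1 h4) t2) _; rewrite ?normc_ge0 //.
    by apply: le_trans W; apply: eq_ler; ring.
  have h4 : (N <= 4 * b)%N by clear -Nab hab; lia.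
  apply: le_trans (ler_pM _ _ t1 (s2 h4)) _; rewrite ?normc_ge0 //.
  by apply: le_trans W; apply: eq_ler; ring.
have Y0 : (0 < N ^ E)%N by rewrite expn_gt0 N0.
have [Y2 eY2] : exists Y2 : R, Y2 = (#|F| * (N ^ E) ^ 2)%:R * T by eexists.
have Y20 : 0 <= Y2 by rewrite eY2 mulr_ge0.
have X0 : 0 < N%:R ^+ E :> R by rewrite exprn_gt0.
have Xa n : (N ^ C < #|F| ^ n)%N -> (N%:R ^+ E) ^+ 2 <= q ^+ n :> R.
  by move=> h; rewrite -exprM mulnC -hC -!natrX ler_nat ltnW.
apply: (@le_trans _ _ (\sum_(r < N.+1) (N.+1%:R * Y2 + N.+1%:R ^+ 2 * P0))).
  rewrite big_mkcond; apply: ler_sum => r _; case: ifP => [gr|_]; last first.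
    by rewrite addr_ge0 ?mulr_ge0 ?exprn_ge0.
  have rN : (r.+1%:R : R) <= N.+1%:R by rewrite ler_nat ltn_ord.
  apply: (@le_trans _ _ (\sum_(m <- mons F r) ((phi m)%:R^-1 * Y2 +
     \sum_(d <- divs m) large_part psi1 psi2 a b (N ^ E) d (m %/ d)))).
    rewrite big_seq [leRHS]big_seq; apply: ler_sum => m; rewrite mem_mons => /andP[mm _].
    by rewrite eY2; apply: charbound_split => // i d im np cd hd; exact: hT cd hd.
  rewrite big_split /= lerD //.
    rewrite -big_distrl /= ler_wpM2r //; exact: le_trans (sum_inv_phi R F r) rN.
  apply: le_trans (large_total (P0 := P0) P00 _) _; last first.
    by rewrite ler_wpM2r // lerXn2r ?nnegrE.
  move=> s d sr Ys; rewrite eP0; apply: large_block => //.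
  - by rewrite mulr_gt0 ?exprn_gt0.
  - by apply: le_trans ha2 _; apply: eq_ler; ring.
  - by apply: le_trans hb2 _; apply: eq_ler; ring.
  - by rewrite -!natrX ler_nat ltnW.
  - exact: Xa.
  - exact: Xa.
  apply: le_trans gr; rewrite lerXn2r ?nnegrE ?mulr_ge0 ?exprn_ge0 ?(ltW q0) //.
  rewrite ler_pM ?exprn_ge0 ?(ltW q0) //; exact: ler_weXn2l.
rewrite sumr_const card_ord -[leLHS]mulr_natl mulrDr mulrDl.
have s2 := succ_le2 N0.
apply: lerD.
  apply: (@le_trans _ _ (2 * N%:R * (2 * N%:R * Y2))).
    by rewrite ler_pM ?mulr_ge0 // ler_wpM2r.
  rewrite eY2 eT natrM !natrX.
  apply: (@le_trans _ _ (4 * q * (Ks * K) * q ^+ N * (N%:R ^+ (2 * E + c + 2) / N%:R ^+ G))).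
    have -> : N%:R ^+ (2 * E + c + 2) = (N%:R ^+ E) ^+ 2 * N%:R ^+ c * N%:R ^+ 2 :> R.
      by rewrite 2!exprD [(2 * E)%N]mulnC exprM.
    by apply: eq_ler; ring.
  rewrite [leRHS]mulrA ler_wpM2l ?mulr_ge0 ?exprn_ge0 ?(ltW q0) ?(ltW K0) //.
  by apply: pow_absorb; rewrite // hG.
apply: (@le_trans _ _ (2 * N%:R * ((2 * N%:R) ^+ 2 * P0))).
  by rewrite ler_pM ?mulr_ge0 ?exprn_ge0 // ler_wpM2r // lerXn2r ?nnegrE ?mulr_ge0.
apply: (@le_trans _ _ (16 * q * K * q ^+ N * (N%:R ^+ (c + 3) / N%:R ^+ E))).
  by apply: eq_ler; rewrite eP0 exprD; ring.
rewrite [leRHS]mulrA ler_wpM2l ?mulr_ge0 ?exprn_ge0 ?(ltW q0) ?(ltW K0) //.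
by apply: pow_absorb; rewrite // hE; clear; lia.
Qed.

(** The majorant V is free of l, and B and T do not depend on N, a or b, so the bounds can be added
    over all pairs of degrees. *)
Lemma pair_bound psi1 psi2 (A : nat) :
  growth_condition psi1 -> growth_condition psi2 ->
  siegel_walfisz psi1 -> siegel_walfisz psi2 ->
  bombieri_vinogradov psi1 -> bombieri_vinogradov psi2 ->
  exists2 B : R, 0 < B & exists2 T : R, 0 <= T &
  forall N a b, (0 < N)%N -> (a + b <= N)%N ->
  exists V : {poly F} -> R, [/\ forall m, m \is monic -> 0 <= V m,
    forall m l, m \is monic -> coprimep l m ->
      normc (bilinear_error psi1 psi2 a b m l) <= V m &
    \sum_(m <- mods N B) V m <= T * (q ^+ N / N%:R ^+ A)].
Proof.
move=> /level_moments[c1 [K1 K10 g1]] /level_moments[c2 [K2 K20 g2]] s1 s2 b1 b2.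
pose c := (c1 + c2)%N; pose K := K1 + K2 + 1.
have K0 : 0 < K by rewrite ltr_wpDl ?addr_ge0.
have KK1 : K1 <= K by rewrite /K -addrA lerDl addr_ge0.
have KK2 : K2 <= K by rewrite /K addrAC lerDr addr_ge0.
pose E := (A + c + 3)%N; pose C := (2 * E)%N; pose G := (2 * E + c + 2 + A)%N.
(* Large enough both for the bilinear range, which needs e >= E, and for the short range, which
   needs e >= A + 2c + 1. *)
pose e := (E + c)%N.
have [S1 S10 sw1] := siegel_walfisz_power E G s1.
have [S2 S20 sw2] := siegel_walfisz_power E G s2.
have [B1 B10 [L1 L10 bv1]] := bv_maxerr (C + c + A) b1.
have [B2 B20 [L2 L20 bv2]] := bv_maxerr (C + c + A) b2.
pose B := B1 + B2 + e%:R.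
have B0 : 0 < B by rewrite ltr_wpDr // addr_gt0.
have BB1 : B1 <= B by rewrite /B -addrA lerDl addr_ge0 // ltW.
have BB2 : B2 <= B by rewrite /B addrAC lerDr addr_ge0 // ltW.
have eB : e%:R <= B by rewrite /B lerDr addr_ge0 // ltW.
pose T1 : R := 4 * K ^+ 2.
pose T2 : R := 32 * q ^+ 16 * K ^+ 2 * 16 ^+ (2 * c) * 16 ^+ A.
pose T3 := K * L1; pose T4 := K * L2.
pose T5 := 4 * q * ((S1 + S2) * K) + 16 * q * K.
have q0 := q_gt0 R F; have kk := ltW K0.
have T10 : 0 <= T1 by rewrite !mulr_ge0 ?exprn_ge0.
have T20 : 0 <= T2 by rewrite !mulr_ge0 ?exprn_ge0 ?(ltW q0).
have T30 : 0 <= T3 by rewrite mulr_ge0.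
have T40 : 0 <= T4 by rewrite mulr_ge0.
have T50 : 0 <= T5 by rewrite addr_ge0 // !mulr_ge0 ?addr_ge0 ?(ltW q0).
exists B => //; exists (T1 + T2 + T3 + T4 + T5); first by do 4!(apply: addr_ge0 => //).
move=> N a b N0 abN; have aN : (a <= N)%N by apply: leq_trans abN; rewrite leq_addr.
have bN : (b <= N)%N by apply: leq_trans abN; rewrite leq_addl.
have [m1 m1'] := g1 c K N a (leq_addr _ _) KK1 N0 aN.
have [m2 m2'] := g2 c K N b (leq_addl _ _) KK2 N0 bN.
have W0 : 0 <= q ^+ N / N%:R ^+ A by rewrite divr_ge0 ?exprn_ge0 ?(ltW q0).
have fin (t : R) V : t <= T1 + T2 + T3 + T4 + T5 ->
  [/\ forall m, m \is monic -> 0 <= V m,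
    forall m l, m \is monic -> coprimep l m ->
      normc (bilinear_error psi1 psi2 a b m l) <= V m &
    \sum_(m <- mods N B) V m <= t * (q ^+ N / N%:R ^+ A)] ->
  exists V : {poly F} -> R, [/\ forall m, m \is monic -> 0 <= V m,
    forall m l, m \is monic -> coprimep l m ->
      normc (bilinear_error psi1 psi2 a b m l) <= V m &
    \sum_(m <- mods N B) V m <= (T1 + T2 + T3 + T4 + T5) * (q ^+ N / N%:R ^+ A)].
  move=> tT [h1 h2 h3]; exists V; split => //.
  by apply: le_trans h3 _; rewrite ler_wpM2r.
have [le1 le2 le3 le4 le5] : [/\ T1 <= T1 + T2 + T3 + T4 + T5, T2 <= T1 + T2 + T3 + T4 + T5,
   T3 <= T1 + T2 + T3 + T4 + T5, T4 <= T1 + T2 + T3 + T4 + T5 & T5 <= T1 + T2 + T3 + T4 + T5].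
  by clear -T10 T20 T30 T40 T50; move: T1 T2 T3 T4 T5 T10 T20 T30 T40 T50 =>
     t1 t2 t3 t4 t5 *; split; lra.
pose S : R := 2 * ((\sum_(g <- mons F a) normc (psi1 g)) * (\sum_(h <- mons F b) normc (psi2 h))).
have n1 : 0 <= \sum_(g <- mons F a) normc (psi1 g) by apply: sumr_ge0 => *; exact: normc_ge0.
have n2 : 0 <= \sum_(g <- mons F b) normc (psi2 g) by apply: sumr_ge0 => *; exact: normc_ge0.
have SS0 : 0 <= S by rewrite !mulr_ge0.
have hS : S <= 2 * (K ^+ 2 * (q ^+ (a + b) * N%:R ^+ (2 * c))).
  rewrite ler_wpM2l //; apply: le_trans (ler_pM n1 n2 m1 m2) _.
  by apply: eq_ler; rewrite exprD mulnC exprM; ring.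
have triv m l : m \is monic -> coprimep l m ->
    normc (bilinear_error psi1 psi2 a b m l) <= S.
  by move=> mm _; exact: bilinear_error_triv.
have [h16|h16] := ltnP N 16.
  apply: (fin T2 (fun=> S)) => //; split=> //.
  apply: le_trans (sum_mods_good N0 eB _) _ => //.
  exact: (@case_trivial_small c A e N a b K S kk N0 h16 abN SS0 hS).
have [hab|hab] := leqP (2 * (a + b)) N.
  apply: (fin T1 (fun=> S)) => //; split=> //.
  apply: le_trans (sum_mods_good N0 eB _) _ => //.
  apply: (@case_trivial_short c A e N a b K S kk N0 _ hab SS0 hS).
  by rewrite /e /E; clear; lia.
have [hb|hb] := leqP (#|F| ^ b) (N ^ C).
  have [V hV] := @case_small psi1 psi2 c C A N a b B K L1 kk N0 aN L10 (bv1 N B N0 BB1) m2 hb.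
  exact: (fin T3 V).
have [ha|ha] := leqP (#|F| ^ a) (N ^ C).
  have [V [h1 h2 h3]] :=
    @case_small psi2 psi1 c C A N b a B K L2 kk N0 bN L20 (bv2 N B N0 BB2) m1 ha.
  by apply: (fin T4 V) => //; split => // m l mm cl; rewrite bilinear_errorC h2.
apply: (fin T5 (charbound psi1 psi2 a b)) => //; split.
- by move=> m _; exact: charbound_ge0.
- by move=> m l; exact: bilinear_error_le.
apply: le_trans (sum_mods_good N0 eB _) _; first by move=> m _; exact: charbound_ge0.
apply: (@case_main psi1 psi2 c A E C G e N a b K (S1 + S2)) => //.
- by rewrite addr_ge0.
- by rewrite leq_addr.
have z n : 0 <= q ^+ n / N%:R ^+ G.
  by rewrite divr_ge0 ?exprn_ge0 ?(ltW q0).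
move=> m d chi m0 ch np cd hd; split=> h4.
  apply: le_trans (sw1 N a m d chi h16 h4 m0 ch np cd hd) _.
  by rewrite ler_wpM2r ?z // lerDl.
apply: le_trans (sw2 N b m d chi h16 h4 m0 ch np cd hd) _.
by rewrite ler_wpM2r ?z // lerDr.
Qed.

(** The maximum over M <= N is bounded by a sum, and each M splits into at most N + 1 pairs of
    degrees. These (N + 1)^2 terms cost two powers of N, which is why [pair_bound] is called with
    two more than the integer bound k of A. *)
Lemma bombieri_vinogradov_conv psi1 psi2 :
  growth_condition psi1 -> growth_condition psi2 ->
  siegel_walfisz psi1 -> siegel_walfisz psi2 ->
  bombieri_vinogradov psi1 -> bombieri_vinogradov psi2 ->
  bombieri_vinogradov (dirichlet_conv psi1 psi2).
Proof.
move=> hG1 hG2 hS1 hS2 hB1 hB2 A A0; pose k := Num.bound A.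
have [B B0 [T T0 hT]] := pair_bound k.+2 hG1 hG2 hS1 hS2 hB1 hB2.
exists B => //; exists (4 * T) => N N0.
rewrite (sum_mods N B (fun m => maxerr (dirichlet_conv psi1 psi2) N m)).
have q0 := q_gt0 R F; have N1 : 1 <= N%:R :> R by rewrite ler1n.
have x0 : 0 < N%:R :> R by rewrite ltr0n.
have W0 : 0 <= q ^+ N / N%:R ^+ k.+2 by rewrite divr_ge0 ?exprn_ge0 ?(ltW q0).
have hV p : exists V : {poly F} -> R, (p.1 + p.2 <= N)%N ->
    [/\ forall m, m \is monic -> 0 <= V m,
    forall m l, m \is monic -> coprimep l m ->
      normc (bilinear_error psi1 psi2 p.1 p.2 m l) <= V m &
    \sum_(m <- mods N B) V m <= T * (q ^+ N / N%:R ^+ k.+2)].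
  have [h|h] := leqP (p.1 + p.2) N; last by exists (fun=> 0).
  by have [V hV] := hT N p.1 p.2 N0 h; exists V.
have [V VP] := choice hV.
have VP' M (a : nat) : (M <= N)%N -> (a <= M)%N -> _ := fun MN aM =>
  VP (a, (M - a)%N) (eq_ind_r (fun n => (n <= N)%N) MN (subnKC aM)).
apply: (@le_trans _ _ (\sum_(m <- mods N B) \sum_(M < N.+1) \sum_(a < M.+1) V (val a, (M - a)%N) m)).
  rewrite big_seq [leRHS]big_seq; apply: ler_sum => m /modsP mm.
  have V0 (M : 'I_N.+1) : 0 <= \sum_(a < M.+1) V (val a, (M - a)%N) m.
    by apply: sumr_ge0 => a _; have [h _ _] := VP' M a (ltn_ord M) (ltn_ord a); exact: h.
  apply: maxerr_le; first by apply: sumr_ge0 => M _; exact: V0.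
  move=> M l MN cl; have MN' : (M < N.+1)%N by [].
  rewrite (bigD1 (Ordinal MN')) //= -[leLHS]addr0 lerD //; last first.
    by apply: sumr_ge0 => M' _; exact: V0.
  rewrite progression_error_conv; apply: le_trans (normc_sum _ _ _) _.
  apply: ler_sum => a _; have [_ h _] := VP' M a MN (ltn_ord a).
  by apply: h; rewrite // coprimep_sym.
rewrite exchange_big /=.
apply: (@le_trans _ _ (\sum_(M < N.+1) \sum_(a < N.+1) T * (q ^+ N / N%:R ^+ k.+2))).
  apply: ler_sum => M _; rewrite exchange_big /=.
  apply: (@le_trans _ _ (\sum_(a < M.+1) T * (q ^+ N / N%:R ^+ k.+2))).
    by apply: ler_sum => a _; have [_ _ h] := VP' M a (ltn_ord M) (ltn_ord a).
  rewrite !sumr_const !card_ord -[leLHS]mulr_natl -[leRHS]mulr_natl.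
  by apply: ler_wpM2r; [exact: mulr_ge0|rewrite ler_nat].
rewrite !sumr_const !card_ord -mulrnA -[leLHS]mulr_natl natrM.
have s2 := succ_le2 N0.
apply: (@le_trans _ _ ((2 * N%:R) * (2 * N%:R) * (T * (q ^+ N / N%:R ^+ k.+2)))).
  by apply: ler_wpM2r; [exact: mulr_ge0|rewrite ler_pM].
apply: (@le_trans _ _ (4 * T * q ^+ N * (N%:R ^+ 2 / N%:R ^+ k.+2))).
  by apply: eq_ler; ring.
rewrite [leRHS]mulrA ler_wpM2l ?mulr_ge0 ?exprn_ge0 ?(ltW q0) //.
apply: (@le_trans _ _ (N%:R ^+ k)^-1); first exact: pow_absorb.
rewrite lef_pV2 ?posrE ?exprn_gt0 ?powR_gt0 // -powR_mulrn ?ler0n //.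
by apply: ler_powR => //; apply/ltW/archi_boundP/ltW.
Qed.
End BombieriVinogradov.

Theorem theorem1p1 (R : realType) (F : finFieldType)
    (psi1 psi2 : {poly F} -> R[i])
    (hG1 : growth_condition psi1) (hS1 : siegel_walfisz psi1)
    (hB1 : bombieri_vinogradov psi1)
    (hG2 : growth_condition psi2) (hS2 : siegel_walfisz psi2)
    (hB2 : bombieri_vinogradov psi2) :
  [/\ growth_condition (dirichlet_conv psi1 psi2),
      siegel_walfisz (dirichlet_conv psi1 psi2) &
      bombieri_vinogradov (dirichlet_conv psi1 psi2)].
Proof.
split.
- exact: growth_conv.
- exact: siegel_walfisz_conv.
- exact: bombieri_vinogradov_conv.
Qed.
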